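(* Let $C$ be a coalgebra over a field $k$, let $\{S_i : i\in I\}$ be a complete set of representatives of the isomorphism types of simple right $C$-comodules, and for every $i\in I$ let $T_i:\mathcal{M}^C\to\mathcal{M}^C/\mathcal{T}_{E(S_i)}$ denote the localization functor. A right $C$-comodule $M$ is strictly quasi-finite if and only if $T_i(M)$ is artinian for every $i\in I$.
   Context: $\mathcal{M}^C$ is the category of right $C$-comodules, $\mathrm{Com}_C(-,-)$ its Hom bifunctor, $E(S)$ the injective hull of $S$ in $\mathcal{M}^C$. For a simple right $C$-comodule $S$, $\mathcal{T}_{E(S)}$ is the localizing subcategory of all $M\in\mathcal{M}^C$ with $\mathrm{Com}_C(M,E(S))=0$. The quotient category $\mathcal{M}^C/\mathcal{T}$ by a localizing subcategory $\mathcal{T}$ is the abelian category determined up to equivalence by an exact functor $\mathcal{M}^C\to\mathcal{M}^C/\mathcal{T}$ (the localization functor) with kernel $\mathcal{T}$ and a right adjoint such that the counit of the adjunction is an isomorphism. ''Artinian'' means artinian object of $\mathcal{M}^C/\mathcal{T}_{E(S_i)}$. A right $C$-comodule $M$ is quasi-finite if $\mathrm{Com}_C(S,M)$ is finite-dimensional over $k$ for every simple right $C$-comodule $S$, and strictly quasi-finite if $M/M'$ is quasi-finite for every subcomodule $M'$ of $M$. *)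

(* Defs.v *)
From HB Require Import structures.
From mathcomp Require Import all_boot all_algebra.
From mathcomp Require Import boolp functions.
From mathcomp.multinomials Require Import freeg.

Set Implicit Arguments.
Unset Strict Implicit.
Unset Printing Implicit Defensive.

Import GRing.Theory.
Local Open Scope ring_scope.
Local Open Scope quotient_scope.

Record subspace (k : fieldType) (V : lmodType k) := Subspace {
  subspace_pred :> {pred V};
  subspaceP : submod_closed subspace_pred
}.

HB.instance Definition _ (k : fieldType) (V : lmodType k) (N : subspace V) :=
  GRing.isSubmodClosed.Build k V (subspace_pred N)
    (GRing.submod_closed_semi (subspaceP N)).

Section Span.
Variables (k : fieldType) (V : lmodType k).

Definition span_pred (A : V -> Prop) : {pred V} :=
  [pred x : V | `[< forall N : subspace V, (forall a, A a -> a \in N) -> x \in N >]].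

Lemma span_closed A : submod_closed (span_pred A).
Proof.
split; first by apply/asboolP => N _; exact: rpred0.
move=> a u v /asboolP uA /asboolP vA; apply/asboolP => N AN.
by rewrite rpredD ?rpredZ ?uA ?vA.
Qed.

Definition span A : subspace V := Subspace (span_closed A).

Lemma mem_span (A : V -> Prop) x : A x -> x \in span A.
Proof. by move=> Ax; apply/asboolP => N; apply. Qed.

Lemma span_sub (A : V -> Prop) (N : subspace V) :
  (forall a, A a -> a \in N) -> forall x, x \in span A -> x \in N.
Proof. by move=> AN x /asboolP; apply. Qed.

End Span.

Definition finite_dimensional (k : fieldType) (V : lmodType k) : Prop :=
  exists s : seq V, forall v, v \in span (fun x => x \in s).

Definition quotient (k : fieldType) (V : lmodType k) (N : subspace V) : Type :=
  Quotient.quot (subspace_pred N).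

Section Quotient.
Variables (k : fieldType) (V : lmodType k) (N : subspace V).

HB.instance Definition _ := GRing.Zmodule.on (quotient N).

Definition qproj (x : V) : quotient N :=
  \pi_(Quotient.quot (subspace_pred N)) x.
Definition qrepr (x : quotient N) : V :=
  repr (x : Quotient.quot (subspace_pred N)).

Lemma qreprK : cancel qrepr qproj. Proof. exact: reprK. Qed.

Lemma qproj_eq x y : qproj x = qproj y <-> x - y \in N.
Proof.
rewrite (Quotient.idealrBE (subspace_pred N)); split => [xy|/eqP] //.
exact/eqP.
Qed.

Lemma qprojB : zmod_morphism qproj.
Proof. exact: (@pi_is_zmod_morphism _ _ _ (Quotient.quot (subspace_pred N))). Qed.

Lemma qprojD x y : qproj (x + y) = qproj x + qproj y.
Proof.
have q0 : qproj 0 = 0 by rewrite -(subrr 0) qprojB subrr.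
have qN z : qproj (- z) = - qproj z by rewrite -sub0r qprojB q0 sub0r.
by rewrite -{1}(opprK y) qprojB qN opprK.
Qed.

Definition qscale (a : k) (x : quotient N) : quotient N := qproj (a *: qrepr x).

Lemma qscale_proj a x : qscale a (qproj x) = qproj (a *: x).
Proof.
apply/qproj_eq; rewrite -scalerBr rpredZ //.
by apply/qproj_eq; rewrite qreprK.
Qed.

Lemma qscaleA a b x : qscale a (qscale b x) = qscale (a * b) x.
Proof. by rewrite -(qreprK x) !qscale_proj scalerA. Qed.
Lemma qscale1 : left_id 1 qscale.
Proof. by move=> x; rewrite -(qreprK x) qscale_proj scale1r. Qed.
Lemma qscaleDr : right_distributive qscale +%R.
Proof.
move=> a x y; rewrite -(qreprK x) -(qreprK y).
by rewrite -qprojD !qscale_proj scalerDr qprojD.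
Qed.
Lemma qscaleDl x : {morph qscale^~ x : a b / a + b}.
Proof. by move=> a b; rewrite -(qreprK x) !qscale_proj scalerDl qprojD. Qed.

HB.instance Definition _ := GRing.Zmodule_isLmodule.Build k (quotient N)
  qscaleA qscale1 qscaleDr qscaleDl.

Lemma qprojZ : scalable qproj.
Proof. by move=> a x; rewrite -qscale_proj. Qed.

HB.instance Definition _ := GRing.isZmodMorphism.Build V (quotient N) qproj qprojB.
HB.instance Definition _ := GRing.isScalable.Build k V (quotient N) *:%R qproj qprojZ.

Lemma qproj0 x : qproj x = 0 <-> x \in N.
Proof. by rewrite -(raddf0 qproj) qproj_eq subr0. Qed.

End Quotient.

Section LinearFun.
Variables (k : fieldType) (V W : lmodType k) (f : V -> W).
Hypothesis fl : linear f.

Lemma linear_fun0 : f 0 = 0.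
Proof. by have := fl (-1) 0 0; rewrite !scaleN1r oppr0 addr0 addNr. Qed.
Lemma linear_funZ a x : f (a *: x) = a *: f x.
Proof. by rewrite -(addr0 (a *: x)) fl linear_fun0 addr0. Qed.
Lemma linear_funD x y : f (x + y) = f x + f y.
Proof. by rewrite -{1}(scale1r x) fl scale1r. Qed.
Lemma linear_funB x y : f (x - y) = f x - f y.
Proof. by rewrite linear_funD -scaleN1r linear_funZ scaleN1r. Qed.

End LinearFun.

Section FreeLift.
Variables (k : fieldType) (K : choiceType) (M : lmodType k) (f : K -> M).

Lemma fglift_sumE (D : {freeg K / k}) :
  fglift f D = \sum_(z <- dom D) coeff z D *: f z.
Proof.
have fB := lift_is_additive f.
have f0 : fglift f 0 = 0 by rewrite -(subrr 0) fB subrr.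
have fD x y : fglift f (x + y) = fglift f x + fglift f y.
  have fN z : fglift f (- z) = - fglift f z by rewrite -sub0r fB f0 sub0r.
  by rewrite -{1}(opprK y) fB fN opprK.
rewrite -{1}(freeg_sumE D) (big_morph _ fD f0).
by apply: eq_bigr => z _; rewrite liftU.
Qed.

Lemma fglift_is_linear : linear (fglift f : {freeg K / k} -> M).
Proof.
have fB := lift_is_additive f.
have f0 : fglift f 0 = 0 by rewrite -(subrr 0) fB subrr.
have fD x y : fglift f (x + y) = fglift f x + fglift f y.
  have fN z : fglift f (- z) = - fglift f z by rewrite -sub0r fB f0 sub0r.
  by rewrite -{1}(opprK y) fB fN opprK.
move=> a x y; rewrite fD; congr (_ + _).
rewrite (fglift_sumE x) scaler_sumr {1}/GRing.scale /= /fgscale.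
rewrite (big_morph _ fD f0).
by apply: eq_bigr => z _; rewrite liftU scalerA.
Qed.

End FreeLift.

Section Tensor.
Variables (k : fieldType) (V W : lmodType k).

Local Notation F := {freeg (V * W)%type / k}.
Local Notation "<< v , w >>" := ([freeg [:: (1, (v, w))]] : F).

Inductive tensor_relation : F -> Prop :=
| TensorLinearl a v v' w :
    tensor_relation (<< a *: v + v', w >> - (a *: << v, w >> + << v', w >>))
| TensorLinearr a v w w' :
    tensor_relation (<< v, a *: w + w' >> - (a *: << v, w >> + << v, w' >>)).

Definition tensor : Type := quotient (span tensor_relation).
HB.instance Definition _ := GRing.Lmodule.on tensor.

Definition tens (v : V) (w : W) : tensor := qproj (span tensor_relation) << v, w >>.

(* The linear map induced by a bilinear [f]; no meaning otherwise. *)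
Definition tensor_lift (Z : lmodType k) (f : V -> W -> Z) (t : tensor) : Z :=
  fglift (fun vw => f vw.1 vw.2) (qrepr t : F).

End Tensor.

Definition is_bilinear (k : fieldType) (V W Z : lmodType k) (f : V -> W -> Z) :=
  (forall v, linear (f v)) /\ (forall w, linear (f^~ w)).

Section TensorTheory.
Variables (k : fieldType) (V W : lmodType k).
Local Notation F := {freeg (V * W)%type / k}.
Local Notation tensor := (tensor V W).

Lemma tens_linearl (w : W) : linear ((@tens k V W)^~ w).
Proof.
move=> a v v'; rewrite /tens -linearP; apply/qproj_eq; apply: mem_span.
exact: TensorLinearl.
Qed.

Lemma tens_linearr (v : V) : linear (tens v : W -> tensor).
Proof.
move=> a w w'; rewrite /tens -linearP; apply/qproj_eq; apply: mem_span.
exact: TensorLinearr.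
Qed.

Section Lift.
Variables (Z : lmodType k) (f : V -> W -> Z) (f_bilinear : is_bilinear f).

Let Lf : F -> Z := fglift (fun vw => f vw.1 vw.2).

Fact ker_closed : submod_closed [pred x : F | Lf x == 0].
Proof.
have Ll : linear Lf by exact: fglift_is_linear.
split => [|a u v]; rewrite !inE.
  by rewrite (linear_fun0 Ll).
by move=> /eqP u0 /eqP v0; rewrite Ll u0 v0 scaler0 addr0.
Qed.

Lemma tensor_lift_proj x : tensor_lift f (qproj (span (@tensor_relation k V W)) x) = Lf x.
Proof.
have Ll : linear Lf by exact: fglift_is_linear.
have LB u v : Lf (u - v) = Lf u - Lf v by exact: linear_funB.
apply/eqP; rewrite -subr_eq0 -LB.
set N := span (@tensor_relation k V W).
have : qrepr (qproj N x) - x \in N by apply/qproj_eq; rewrite qreprK.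
apply: (@span_sub _ _ _ (Subspace ker_closed)).
case: f_bilinear => fr fl.
move=> _ [a v v' w|a v w w']; apply/eqP; rewrite LB Ll /Lf !liftU /= !scale1r.
  by rewrite (fl w) subrr.
by rewrite (fr v) subrr.
Qed.

Lemma tensor_liftE v w : tensor_lift f (tens v w) = f v w.
Proof. by rewrite /tens tensor_lift_proj /Lf liftU scale1r. Qed.

Lemma tensor_lift_linear : linear (tensor_lift f).
Proof.
have Ll : linear Lf by exact: fglift_is_linear.
move=> a s t; rewrite -(qreprK s) -(qreprK t) -linearP.
by rewrite !tensor_lift_proj Ll.
Qed.

End Lift.

Lemma tensor_ind (P : tensor -> Prop) :
  P 0 -> (forall a v w t, P t -> P (a *: tens v w + t)) -> forall t, P t.
Proof.
move=> P0 PS t; rewrite -(qreprK t) -(freeg_sumE (qrepr t)).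
elim: (dom _) => [|[v w] s IHs]; first by rewrite big_nil linear0.
rewrite big_cons linearD /=.
set c := coeff _ _.
have -> : [freeg [:: (c, (v, w))]] = c *: [freeg [:: (1, (v, w))]] :> F.
  by apply/eqP/freeg_eqP => z; rewrite coeffZ !coeffU mul1r.
rewrite linearZ /=; exact: PS.
Qed.

Lemma tensor_ext (Z : lmodType k) (g h : tensor -> Z) :
  linear g -> linear h -> (forall v w, g (tens v w) = h (tens v w)) -> g =1 h.
Proof.
move=> gl hl gh.
apply: tensor_ind => [|a v w t IH]; last by rewrite gl hl gh IH.
by rewrite !linear_fun0.
Qed.

End TensorTheory.

(* Keeps unification from unfolding the quotient construction. *)
Global Opaque tensor.

Definition tensor_map (k : fieldType) (V W V' W' : lmodType k)
    (f : V -> V') (g : W -> W') : tensor V W -> tensor V' W' :=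
  tensor_lift (fun v w => tens (f v) (g w)).

Definition tensor_assoc (k : fieldType) (U V W : lmodType k) :
    tensor (tensor U V) W -> tensor U (tensor V W) :=
  tensor_lift (fun t w => tensor_lift (fun u v => tens u (tens v w)) t).

Section TensorMap.
Variable k : fieldType.

Lemma tensor_map_bilinear (V W V' W' : lmodType k) (f : V -> V') (g : W -> W') :
  linear f -> linear g -> is_bilinear (fun v w => tens (f v) (g w)).
Proof.
move=> fl gl; split=> [v a w w'|w a v v'].
  by rewrite gl tens_linearr.
by rewrite fl tens_linearl.
Qed.

Lemma tensor_mapE (V W V' W' : lmodType k) (f : V -> V') (g : W -> W') :
  linear f -> linear g ->
  forall v w, tensor_map f g (tens v w) = tens (f v) (g w).
Proof. by move=> fl gl v w; rewrite /tensor_map tensor_liftE //; exact: tensor_map_bilinear. Qed.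

Lemma tensor_map_linear (V W V' W' : lmodType k) (f : V -> V') (g : W -> W') :
  linear f -> linear g -> linear (tensor_map f g).
Proof. by move=> fl gl; apply: tensor_lift_linear; exact: tensor_map_bilinear. Qed.

Lemma tensor_assoc_bilinear (U V W : lmodType k) (w : W) :
  is_bilinear (fun (u : U) (v : V) => tens u (tens v w)).
Proof.
split=> [u a v v'|v a u u']; last by rewrite tens_linearl.
by rewrite tens_linearl tens_linearr.
Qed.

Lemma tensor_assoc_bilinear2 (U V W : lmodType k) :
  is_bilinear (fun (t : tensor U V) (w : W) =>
    tensor_lift (fun u v => tens u (tens v w)) t).
Proof.
split=> [t|w]; last by apply: tensor_lift_linear; exact: tensor_assoc_bilinear.
move=> a w w'; move: t.
apply: (@tensor_ext k U V _ _
  (fun t => a *: tensor_lift (fun u v => tens u (tens v w)) t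
          + tensor_lift (fun u v => tens u (tens v w')) t)).
- by apply: tensor_lift_linear; exact: tensor_assoc_bilinear.
- have l1 := tensor_lift_linear (@tensor_assoc_bilinear U V W w).
  have l2 := tensor_lift_linear (@tensor_assoc_bilinear U V W w').
  move=> b s t; rewrite l1 l2 !scalerDr !scalerA [a * b]mulrC -!addrA.
  by congr (_ + _); rewrite addrCA.
move=> u v; rewrite !tensor_liftE; try exact: tensor_assoc_bilinear.
by rewrite !tens_linearr.
Qed.

Lemma tensor_assocE (U V W : lmodType k) (u : U) (v : V) (w : W) :
  tensor_assoc (tens (tens u v) w) = tens u (tens v w).
Proof.
rewrite /tensor_assoc tensor_liftE; last exact: tensor_assoc_bilinear2.
by rewrite tensor_liftE //; exact: tensor_assoc_bilinear.
Qed.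

Lemma tensor_assoc_linear (U V W : lmodType k) :
  linear (@tensor_assoc k U V W).
Proof. by apply: tensor_lift_linear; exact: tensor_assoc_bilinear2. Qed.

End TensorMap.

Record coalgebra (k : fieldType) := Coalgebra {
  coalg_space :> lmodType k;
  comult : {linear coalg_space -> tensor coalg_space coalg_space};
  counit : {linear coalg_space -> k^o};
  comultA : forall c,
    tensor_assoc (tensor_map comult id (comult c)) = tensor_map id comult (comult c);
  counitl : forall c, tensor_lift (fun a b => (counit a : k) *: b) (comult c) = c;
  counitr : forall c, tensor_lift (fun a b => (counit b : k) *: a) (comult c) = c
}.

Arguments comult {k C} : rename.
Arguments counit {k C} : rename.

Record comodule (k : fieldType) (C : coalgebra k) := Comodule {
  comod_space :> lmodType k;
  coact : {linear comod_space -> tensor comod_space C};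
  coactA : forall m,
    tensor_assoc (tensor_map coact id (coact m)) = tensor_map id comult (coact m);
  coact_counit : forall m,
    tensor_lift (fun x (c : C) => (counit c : k) *: x) (coact m) = m
}.

Arguments coact {k C M} : rename.

Section Com.
Variables (k : fieldType) (C : coalgebra k) (M N : comodule C).

Definition comodule_morphism (f : M -> N) : Prop :=
  linear f /\ forall m, coact (f m) = tensor_map f id (coact m).

Definition comodule_morphism_pred : {pred M -> N} :=
  [pred f | `[< comodule_morphism f >]].

Lemma comodule_morphism_closed : submod_closed comodule_morphism_pred.
Proof.
have l0 : linear (fun _ : M => 0 : N) by move=> a x y; rewrite scaler0 addr0.
split.
  apply/asboolP; split=> [|m]; first exact: l0.
  rewrite linear0; symmetry.
  apply: (@tensor_ext k M C _ _ (fun _ => 0)).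
  - exact: tensor_map_linear.
  - by move=> a x y; rewrite scaler0 addr0.
  move=> v w; rewrite tensor_mapE //.
  exact: (linear_fun0 (tens_linearl w)).
move=> a f g /asboolP[fl fc] /asboolP[gl gc]; apply/asboolP.
have fgE x : (a *: f + g) x = a *: f x + g x by [].
have hl : linear (a *: f + g).
  move=> b x y; rewrite !fgE fl gl !scalerDr !scalerA [a * b]mulrC -!addrA.
  by congr (_ + _); rewrite addrCA.
split=> // m; rewrite !fgE linearP fc gc; symmetry.
apply: (@tensor_ext k M C _ _
  (fun t => a *: tensor_map f id t + tensor_map g id t)).
- exact: tensor_map_linear.
- have l1 : linear (tensor_map f (id : C -> C)) by exact: tensor_map_linear.
  have l2 : linear (tensor_map g (id : C -> C)) by exact: tensor_map_linear.
  move=> b x y; rewrite l1 l2 !scalerDr !scalerA [a * b]mulrC -!addrA.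
  by congr (_ + _); rewrite addrCA.
by move=> v w; rewrite !tensor_mapE // !fgE tens_linearl.
Qed.

HB.instance Definition _ :=
  GRing.isSubmodClosed.Build k (M -> N : lmodType k) comodule_morphism_pred
    (GRing.submod_closed_semi comodule_morphism_closed).

Record Com := MkCom {
  com_fun :> M -> N;
  com_funP : comodule_morphism_pred com_fun
}.

HB.instance Definition _ := [isSub for com_fun].
HB.instance Definition _ := [Choice of Com by <:].
HB.instance Definition _ := [SubChoice_isSubLmodule of Com by <:].

Lemma comP (f : Com) : comodule_morphism f.
Proof. by case: f => f /= /asboolP. Qed.

Lemma com_eq (f g : Com) : f =1 g -> f = g.
Proof. by move=> fg; apply/val_inj/funext. Qed.

End Com.

Section ComCategory.
Variables (k : fieldType) (C : coalgebra k).
Implicit Types M N P Q : comodule C.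

Fact com_id_subproof M : comodule_morphism_pred (id : M -> M).
Proof.
apply/asboolP; split=> // m; symmetry.
apply: (@tensor_ext k M C _ _ id) => //; first exact: tensor_map_linear.
by move=> v w; rewrite tensor_mapE.
Qed.
Definition com_id M : Com M M := MkCom (com_id_subproof M).

Fact com_comp_subproof M N P (g : Com N P) (f : Com M N) :
  comodule_morphism_pred (g \o f).
Proof.
have [[fl fc] [gl gc]] := (comP f, comP g).
have gfl : linear (g \o f) by move=> a x y; rewrite /= fl gl.
apply/asboolP; split=> // m; rewrite /= gc fc.
apply: (@tensor_ext k M C _ (tensor_map g id \o tensor_map f id)).
- have l1 : linear (tensor_map f (id : C -> C)) by exact: tensor_map_linear.
  have l2 : linear (tensor_map g (id : C -> C)) by exact: tensor_map_linear.
  by move=> a x y; rewrite /= l1 l2.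
- exact: tensor_map_linear.
by move=> v w; rewrite /= !tensor_mapE.
Qed.
Definition com_comp M N P (g : Com N P) (f : Com M N) : Com M P :=
  MkCom (com_comp_subproof g f).

Lemma com_comp1f M N (f : Com M N) : com_comp (com_id N) f = f.
Proof. exact: com_eq. Qed.
Lemma com_compf1 M N (f : Com M N) : com_comp f (com_id M) = f.
Proof. exact: com_eq. Qed.
Lemma com_compA M N P Q (h : Com P Q) (g : Com N P) (f : Com M N) :
  com_comp h (com_comp g f) = com_comp (com_comp h g) f.
Proof. exact: com_eq. Qed.
Lemma com_compDl M N P (g g' : Com N P) (f : Com M N) :
  com_comp (g + g') f = com_comp g f + com_comp g' f.
Proof. exact: com_eq. Qed.
Lemma com_compDr M N P (g : Com N P) (f f' : Com M N) :
  com_comp g (f + f') = com_comp g f + com_comp g f'.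
Proof. by apply: com_eq => x; rewrite /= (linear_funD (comP g).1). Qed.

End ComCategory.

Record subcomodule (k : fieldType) (C : coalgebra k) (M : comodule C) := Subcomodule {
  subcomod_space :> subspace M;
  (* the span below is the image of [N ⊗ C] in [M ⊗ C] *)
  subcomod_coact : forall x, x \in subcomod_space ->
    coact x \in span (fun t : tensor M C =>
      exists n c, n \in subcomod_space /\ t = tens n c)
}.

Section QuotientComodule.
Variables (k : fieldType) (C : coalgebra k) (M : comodule C) (N : subcomodule M).
Local Notation Q := (quotient N).
Local Notation pi := (qproj N).

Let pil : linear pi. Proof. by move=> a x y; rewrite linearP. Qed.
Let pi1l : linear (tensor_map pi (id : C -> C)). Proof. exact: tensor_map_linear. Qed.

Definition quotient_coact (x : Q) : tensor Q C :=
  tensor_map pi id (coact (qrepr x)).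

Lemma quotient_coactE m : quotient_coact (pi m) = tensor_map pi id (coact m).
Proof.
apply/eqP; rewrite -subr_eq0 /quotient_coact -(linear_funB pi1l) -linearB.
have : qrepr (pi m) - m \in (N : subspace M) by apply/qproj_eq; rewrite qreprK.
move=> /(subcomod_coact (s := N)).
have kcl : submod_closed [pred t | tensor_map pi (id : C -> C) t == 0].
  split=> [|a u v]; rewrite !inE; first by rewrite (linear_fun0 pi1l).
  by move=> /eqP u0 /eqP v0; rewrite pi1l u0 v0 scaler0 addr0.
apply: (@span_sub _ _ _ (Subspace kcl)) => _ [n [c [nN ->]]].
rewrite inE /= tensor_mapE //; have /qproj0 -> := nN.
by rewrite (linear_fun0 (tens_linearl _)).
Qed.

Lemma quotient_coact_linear : linear quotient_coact.
Proof.
move=> a x y; rewrite -(qreprK x) -(qreprK y) -linearP !quotient_coactE.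
by rewrite linearP pi1l.
Qed.

HB.instance Definition _ := GRing.isLinear.Build k Q (tensor Q C) *:%R
  quotient_coact quotient_coact_linear.

Lemma quotient_coactA x :
  tensor_assoc (tensor_map quotient_coact id (quotient_coact x)) =
  tensor_map id comult (quotient_coact x).
Proof.
have Dl : linear (comult : C -> tensor C C) by move=> a u v; rewrite linearP.
rewrite -(qreprK x) quotient_coactE; set m := qrepr x.
have idl (V : lmodType k) : linear (id : V -> V) by [].
have pp : linear (tensor_map pi (tensor_map (id : C -> C) (id : C -> C))).
  by apply: tensor_map_linear => //; exact: tensor_map_linear.
have assl (U V W : lmodType k) := @tensor_assoc_linear k U V W.
have cl : linear (coact : M -> tensor M C) by move=> a u v; rewrite linearP.
have -> : tensor_map quotient_coact id (tensor_map pi id (coact m)) =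
          tensor_map (tensor_map pi id) id (tensor_map coact id (coact m)).
  have ql := quotient_coact_linear.
  have l1 : linear (tensor_map quotient_coact (id : C -> C)).
    exact: tensor_map_linear.
  have l2 : linear (tensor_map (tensor_map pi (id : C -> C)) (id : C -> C)).
    exact: tensor_map_linear.
  have l3 : linear (tensor_map (coact : M -> tensor M C) (id : C -> C)).
    exact: (tensor_map_linear cl (idl C)).
  apply: (@tensor_ext k M C _
    (tensor_map quotient_coact id \o tensor_map pi id)
    (tensor_map (tensor_map pi id) id \o tensor_map coact id)).
  - by move=> a u v; rewrite /= pi1l l1.
  - by move=> a u v; rewrite /= l3 l2.
  by move=> u v; rewrite /= !tensor_mapE // quotient_coactE.
have -> : forall t : tensor (tensor M C) C,
    tensor_assoc (tensor_map (tensor_map pi id) id t) =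
    tensor_map pi id (tensor_assoc t).
  have l2 : linear (tensor_map (tensor_map pi (id : C -> C)) (id : C -> C)).
    exact: tensor_map_linear.
  have l4 : linear (tensor_map pi (id : tensor C C -> tensor C C)).
    exact: tensor_map_linear.
  apply: (@tensor_ext k (tensor M C) C _
    (fun t => tensor_assoc (tensor_map (tensor_map pi id) id t))
    (fun t => tensor_map pi id (tensor_assoc t))) => [a u v|a u v|t c].
  - by rewrite l2 assl.
  - by rewrite assl l4.
  rewrite (tensor_mapE pi1l (idl C)); move: t.
  have tl (V W : lmodType k) (w : W) := @tens_linearl k V W w.
  apply: (@tensor_ext k M C _
    (fun t => tensor_assoc (tens (tensor_map pi id t) c))
    (fun t => tensor_map pi id (tensor_assoc (tens t c)))) => [a u v|a u v|u v].
  - by rewrite pi1l tl assl.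
  - by rewrite tl assl l4.
  rewrite (tensor_mapE pil (idl C)) !tensor_assocE.
  by rewrite (tensor_mapE pil (idl _)).
rewrite coactA.
have l5 : linear (tensor_map (id : M -> M) (comult : C -> tensor C C)).
  exact: (tensor_map_linear (idl M) Dl).
have l6 : linear (tensor_map (id : Q -> Q) (comult : C -> tensor C C)).
  exact: (tensor_map_linear (idl Q) Dl).
have l4 : linear (tensor_map pi (id : tensor C C -> tensor C C)).
  exact: tensor_map_linear.
apply: (@tensor_ext k M C _ (tensor_map pi id \o tensor_map id comult)
  (tensor_map id comult \o tensor_map pi id)).
- by move=> a u v; rewrite /= l5 l4.
- by move=> a u v; rewrite /= pi1l l6.
by move=> u v; rewrite /= !tensor_mapE.
Qed.

Lemma counit_bilinear (V : lmodType k) :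
  is_bilinear (fun (x : V) (c : C) => (counit c : k) *: x).
Proof.
split=> [x a c c'|c a x x']; first by rewrite linearP scalerDl scalerA.
by rewrite scalerDr !scalerA mulrC.
Qed.

Lemma quotient_coact_counit x :
  tensor_lift (fun x (c : C) => (counit c : k) *: x) (quotient_coact x) = x.
Proof.
rewrite -(qreprK x) quotient_coactE -[in RHS](coact_counit (qrepr x)).
have l1 := tensor_lift_linear (counit_bilinear M).
have l2 := tensor_lift_linear (counit_bilinear Q).
move: (coact _); apply: tensor_ext => [a u v|a u v|u c].
- by rewrite pi1l l2.
- by rewrite l1 linearP.
rewrite tensor_mapE // !tensor_liftE ?linearZ //; exact: counit_bilinear.
Qed.

Definition quotient_comodule : comodule C :=
  Comodule (comod_space := Q) (coact := quotient_coact)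
    quotient_coactA quotient_coact_counit.

End QuotientComodule.

Section Finiteness.
Variables (k : fieldType) (C : coalgebra k).

Definition simple_comodule (S : comodule C) : Prop :=
  (exists x : S, x <> 0) /\
  forall N : subcomodule S, (forall x, x \in N -> x = 0) \/ (forall x, x \in N).

Definition quasi_finite (M : comodule C) : Prop :=
  forall S : comodule C, simple_comodule S -> finite_dimensional (Com S M).

Definition strictly_quasi_finite (M : comodule C) : Prop :=
  forall N : subcomodule M, quasi_finite (quotient_comodule N).

End Finiteness.

Record preadditive := Preadditive {
  ob :> Type;
  hom : ob -> ob -> zmodType;
  idm : forall X, hom X X;
  mcomp : forall X Y Z, hom Y Z -> hom X Y -> hom X Z;
  mcomp1m : forall X Y (f : hom X Y), mcomp (idm Y) f = f;
  mcompm1 : forall X Y (f : hom X Y), mcomp f (idm X) = f;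
  mcompA : forall X Y Z W (h : hom Z W) (g : hom Y Z) (f : hom X Y),
    mcomp h (mcomp g f) = mcomp (mcomp h g) f;
  mcompDl : forall X Y Z (g g' : hom Y Z) (f : hom X Y),
    mcomp (g + g') f = mcomp g f + mcomp g' f;
  mcompDr : forall X Y Z (g : hom Y Z) (f f' : hom X Y),
    mcomp g (f + f') = mcomp g f + mcomp g f'
}.

Notation "g ** f" := (mcomp g f) (at level 40, left associativity).

Section Category.
Variable A : preadditive.

Definition is_iso (X Y : A) (f : hom X Y) : Prop :=
  exists g : hom Y X, g ** f = idm X /\ f ** g = idm Y.

Definition isomorphic (X Y : A) : Prop := exists f : hom X Y, is_iso f.

Definition mono (X Y : A) (f : hom X Y) : Prop :=
  forall (W : A) (g h : hom W X), f ** g = f ** h -> g = h.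

Definition epi (X Y : A) (f : hom X Y) : Prop :=
  forall (Z : A) (g h : hom Y Z), g ** f = h ** f -> g = h.

Definition is_zero (Z : A) : Prop := idm Z = 0.

Definition is_kernel (K X Y : A) (i : hom K X) (f : hom X Y) : Prop :=
  f ** i = 0 /\
  forall (W : A) (g : hom W X), f ** g = 0 -> exists! h : hom W K, i ** h = g.

Definition is_cokernel (X Y Q : A) (p : hom Y Q) (f : hom X Y) : Prop :=
  p ** f = 0 /\
  forall (W : A) (g : hom Y W), g ** f = 0 -> exists! h : hom Q W, h ** p = g.

Definition is_biproduct (X Y P : A) (i : hom X P) (j : hom Y P)
    (p : hom P X) (q : hom P Y) : Prop :=
  [/\ p ** i = idm X, q ** j = idm Y, q ** i = 0, p ** j = 0
    & i ** p + j ** q = idm P].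

Record abelian : Prop := Abelian {
  abelian_zero : exists Z : A, is_zero Z;
  abelian_biproduct : forall X Y : A,
    exists (P : A) (i : hom X P) (j : hom Y P) (p : hom P X) (q : hom P Y),
      is_biproduct i j p q;
  abelian_kernel : forall (X Y : A) (f : hom X Y),
    exists (K : A) (i : hom K X), is_kernel i f;
  abelian_cokernel : forall (X Y : A) (f : hom X Y),
    exists (Q : A) (p : hom Y Q), is_cokernel p f;
  abelian_normal : forall (X Y : A) (f : hom X Y), mono f ->
    exists (Z : A) (g : hom Y Z), is_kernel f g;
  abelian_conormal : forall (X Y : A) (f : hom X Y), epi f ->
    exists (W : A) (g : hom W X), is_cokernel f g
}.

Definition short_exact (X Y Z : A) (i : hom X Y) (p : hom Y Z) : Prop :=
  is_kernel i p /\ is_cokernel p i.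

Definition injective_object (E : A) : Prop :=
  forall (X Y : A) (u : hom X Y) (f : hom X E), mono u ->
    exists g : hom Y E, g ** u = f.

Definition sub_le (X K L : A) (u : hom K X) (v : hom L X) : Prop :=
  exists h : hom K L, v ** h = u.

Definition artinian (X : A) : Prop :=
  forall (K : nat -> A) (m : forall n, hom (K n) X),
    (forall n, mono (m n)) -> (forall n, sub_le (m n.+1) (m n)) ->
    exists n0, forall n, (n0 <= n)%N -> sub_le (m n0) (m n).

End Category.

Record functor (A B : preadditive) := Functor {
  fob :> A -> B;
  fmap : forall X Y : A, hom X Y -> hom (fob X) (fob Y);
  fmap1 : forall X : A, fmap (idm X) = idm (fob X);
  fmapM : forall (X Y Z : A) (g : hom Y Z) (f : hom X Y),
    fmap (g ** f) = fmap g ** fmap f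
}.

Definition additive_functor (A B : preadditive) (F : functor A B) : Prop :=
  forall (X Y : A) (f g : hom X Y), fmap F (f + g) = fmap F f + fmap F g.

Definition exact_functor (A B : preadditive) (F : functor A B) : Prop :=
  additive_functor F /\
  forall (X Y Z : A) (i : hom X Y) (p : hom Y Z),
    short_exact i p -> short_exact (fmap F i) (fmap F p).

(* [F] is the left adjoint, [G] the right one. *)
Record adjunction (A B : preadditive) (F : functor A B) (G : functor B A) := Adjunction {
  adj_unit : forall X : A, hom X (G (F X));
  adj_counit : forall Y : B, hom (F (G Y)) Y;
  adj_unit_natural : forall (X X' : A) (f : hom X X'),
    adj_unit X' ** f = fmap G (fmap F f) ** adj_unit X;
  adj_counit_natural : forall (Y Y' : B) (g : hom Y Y'),
    g ** adj_counit Y = adj_counit Y' ** fmap F (fmap G g);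
  adj_triangle_left : forall X : A, adj_counit (F X) ** fmap F (adj_unit X) = idm (F X);
  adj_triangle_right : forall Y : B, fmap G (adj_counit Y) ** adj_unit (G Y) = idm (G Y)
}.

(* [P] is the class of objects of a localizing subcategory of [A]. These
   conditions determine [B] up to equivalence: it is the quotient [A/P]. *)
Record localization_functor (A B : preadditive) (P : A -> Prop) (T : functor A B)
    : Prop := LocalizationFunctor {
  loc_abelian : abelian B;
  loc_exact : exact_functor T;
  loc_kernel : forall X : A, is_zero (T X) <-> P X;
  loc_adjoint : exists (G : functor B A) (adj : adjunction T G),
    forall Y : B, is_iso (adj_counit adj Y)
}.

Definition comod_category (k : fieldType) (C : coalgebra k) : preadditive :=
  @Preadditive (comodule C) (fun M N => Com M N) (@com_id k C) (@com_comp k C)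
    (@com_comp1f k C) (@com_compf1 k C) (@com_compA k C)
    (@com_compDl k C) (@com_compDr k C).

Section InjectiveHull.
Variables (k : fieldType) (C : coalgebra k).

Definition essential (S E : comodule C) (j : Com S E) : Prop :=
  forall N : subcomodule E, (forall s, j s \in N -> j s = 0) ->
    forall x, x \in N -> x = 0.

Definition injective_hull (S E : comodule C) : Prop :=
  @injective_object (comod_category C) E /\
  exists j : Com S E, injective j /\ essential j.

Definition torsion (E : comodule C) : comod_category C -> Prop :=
  fun M : comodule C => forall f : Com M E, f = 0.

Definition complete_simples (I : Type) (S : I -> comodule C) : Prop :=
  [/\ forall i, simple_comodule (S i),
      forall i j, @isomorphic (comod_category C) (S i) (S j) -> i = j
    & forall X, simple_comodule X ->
        exists i, @isomorphic (comod_category C) X (S i)].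

End InjectiveHull.

(* Main.v *)
Require Import Defs.
From mathcomp Require Import all_boot all_algebra.
From HB Require Import structures.
From mathcomp Require Import boolp classical_sets.
Import Defs.

(* Write T for the localization at E = E(S).

   If M is strictly quasi-finite, a descending chain m_n of subobjects of T(M)
   with cokernels q_n : T(M) -> Q_n is determined by the kernels N_n of the
   adjoint maps M -> G(Q_n): q_n factors as M -> M/N_n under T, followed by a
   monomorphism. Let N be the intersection of the N_n. A simple subcomodule of
   M/N maps nontrivially to some G(Q_n), hence is not torsion, hence is
   isomorphic to S. So the socle of M/N is a sum of copies of S, and is finite
   because Com(S, M/N) is finite-dimensional; the descending chain N_n/N, whose
   intersection is zero, therefore reaches zero.

   Conversely, let S' be isomorphic to S with Com(S', X) infinite-dimensional,
   X = M/N. Repeatedly choosing g : S' -> X_n nonzero, extending the embedding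
   S' -> E along g to f : X -> E, and intersecting X_n with ker f gives a
   descending chain X_n with a copy of S' in X_n that embeds in X/X_{n+1}:
   Com(S', X_n) stays infinite-dimensional because the maps S' -> E take values
   in the image of S and hence form a finite-dimensional space. The kernels of
   T(M) -> T(X/X_n) then form a strictly descending chain.

   Comodules are handled as modules over the dual algebra of C: since k is a
   field, a subspace is a subcomodule, or a linear map a morphism, if and only
   if it is compatible with all functionals on C. *)

Set Implicit Arguments.
Unset Strict Implicit.
Unset Printing Implicit Defensive.

Import GRing.Theory.
Local Open Scope ring_scope.

(** * Linear algebra over subspaces *)

Section LinearAlgebra.
Variable k : fieldType.
Implicit Types V W : lmodType k.

Lemma subspace_of V (P : V -> Prop) :
  P 0 -> (forall a u v, P u -> P v -> P (a *: u + v)) ->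
  exists N : subspace V, forall x, x \in N <-> P x.
Proof.
move=> P0 PD.
have cl : submod_closed [pred x : V | `[< P x >]].
  by split=> [|a u v /asboolP Pu /asboolP Pv]; apply/asboolP => //; apply: PD.
by exists (Subspace cl) => x; split=> /asboolP.
Qed.

Lemma span_cons V (w : V) (s : seq V) x :
  x \in span (fun v => v \in w :: s) <->
  exists a y, y \in span (fun v => v \in s) /\ x = a *: w + y.
Proof.
split=> [|[a [y [ys ->]]]]; last first.
  apply: rpredD.
    by apply: rpredZ; apply: mem_span; rewrite mem_head.
  apply: span_sub ys => v vs; apply: mem_span; by rewrite inE vs orbT.
have [|a u v [b [y [ys ->]]] [c [z [zs ->]]]|N NP] := @subspace_of V
  (fun x => exists a y, y \in span (fun v => v \in s) /\ x = a *: w + y).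
- by exists 0, 0; rewrite rpred0 scale0r addr0.
- exists (a * b + c), (a *: y + z); split; first by rewrite rpredD ?rpredZ.
  by rewrite scalerDl scalerDr scalerA addrACA.
move=> xs; apply/NP; apply: span_sub xs => v; rewrite inE => /orP[/eqP ->|vs].
  by apply/NP; exists 1, 0; rewrite rpred0 scale1r addr0.
by apply/NP; exists 0, v; rewrite scale0r add0r; split=> //; apply: mem_span.
Qed.

Lemma span_nil V (x : V) : x \in span (fun v => v \in [::]) -> x = 0.
Proof.
have [||N NP] := @subspace_of V (fun x => x = 0) => //.
  by move=> a _ _ -> ->; rewrite scaler0 addr0.
by move=> xs; apply/NP; apply: span_sub xs.
Qed.

Definition spans V (s : seq V) (U : subspace V) : Prop :=
  forall x, x \in U <-> x \in span (fun v => v \in s).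

(** This replaces dimension counting. Induction on [s]: if [U] contains some [u] equal to [w] plus
    an element of the span of the tail, then [u] and generators of the part of [U] inside that span
    generate [U]; otherwise [U] already lies in the span of the tail, and one generator is saved. *)
Lemma subspace_spans V (s : seq V) (U : subspace V) :
  (forall x, x \in U -> x \in span (fun v => v \in s)) ->
  exists t, [/\ spans t U, (size t <= size s)%N &
    size t = size s -> forall x, x \in span (fun v => v \in s) -> x \in U].
Proof.
elim: s U => [|w s IHs] U Us.
  exists [::]; split=> // [x|_ x /span_nil ->]; last exact: rpred0.
  by split=> [/Us //|/span_nil ->]; exact: rpred0.
have [[u uU [y [ys uE]]]|noU] := EM (exists2 u, u \in U &
    exists y, y \in span (fun v => v \in s) /\ u = w + y).
  have [||U' U'P] := @subspace_of V
      (fun x => x \in U /\ x \in span (fun v => v \in s)).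
  - by rewrite !rpred0.
  - by move=> a x z [? ?] [? ?]; rewrite !rpredD ?rpredZ.
  have [x /U'P[] //|t [tU' st te]] := IHs U'.
  exists (u :: t); split=> [x||].
  - rewrite span_cons; split=> [xU|[a [z [zt ->]]]]; last first.
      by have /U'P[zU _] := (tU' z).2 zt; rewrite rpredD ?rpredZ.
    have /span_cons[a [z [zs xE]]] := Us x xU.
    exists a, (x - a *: u); split; last by rewrite addrC subrK.
    apply/tU'/U'P; split; first by rewrite rpredB ?rpredZ.
    rewrite xE uE scalerDr opprD addrACA subrr add0r.
    by rewrite rpredB ?rpredZ.
  - exact: st.
  move=> [] /te sU x /span_cons[a [z [zs ->]]].
  have sU1 v : v \in span (fun v => v \in s) -> v \in U.
    by move=> vs; have /U'P[] := sU v vs.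
  have -> : w = u - y by rewrite uE addrK.
  by apply: rpredD (sU1 _ zs); apply: rpredZ; apply: rpredB uU (sU1 _ ys).
have [x xU|t [tU st te]] := IHs U; last first.
  exists t; split=> [||tsz]; [exact: tU|exact: leqW|].
  by move: st; rewrite tsz ltnn.
have /span_cons[a [z [zs xE]]] := Us x xU.
have [a0|a0] := eqVneq a 0; first by rewrite xE a0 scale0r add0r.
case: noU; exists (a^-1 *: x); first by rewrite rpredZ.
exists (a^-1 *: z); split; first by rewrite rpredZ.
by rewrite xE scalerDr scalerA mulVf // scale1r.
Qed.

(** A member of [F] with the fewest generators is minimal, by the equality case of [subspace_spans].
    This is the descending chain condition in finite dimension. *)
Lemma minimal_subspace V (F : subspace V -> Prop) (s : seq V) (U0 : subspace V) :
  F U0 -> (forall x, x \in U0 -> x \in span (fun v => v \in s)) ->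
  exists2 U, F U & forall U', F U' -> (forall x, x \in U' -> x \in U) ->
    forall x, x \in U -> x \in U'.
Proof.
move=> FU0 U0s; have [t0 [t0U _ _]] := subspace_spans U0s.
have ex : exists n, `[< exists U t, [/\ F U, spans t U & size t = n] >].
  by exists (size t0); apply/asboolP; exists U0, t0.
case: (ex_minnP ex) => n /asboolP[U [t [FU tU tn]]] nmin.
exists U => // U' FU' U'U.
have [x /U'U/tU //|t' [t'U' st' te]] := @subspace_spans V t U'.
move=> x /tU; apply: te; apply/eqP; rewrite eqn_leq st' tn.
by apply: nmin; apply/asboolP; exists U', t'.
Qed.

(** Zorn's lemma gives a maximal subspace [A] that contains [U] and meets [N] trivially; [p] is the
    projection onto [N] along [A]. *)
Lemma complement_exists V (U N : subspace V) :
  (forall x, x \in U -> x \in N -> x = 0) ->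
  exists p : V -> V, [/\ linear p, forall x, p x \in N,
    forall x, x \in N -> p x = x & forall x, x \in U -> p x = 0].
Proof.
move=> UN0.
(* The empty chain has empty union, so [P] must admit the empty set: containing [U] is weakened to
   stability under adding elements of [U]. Maximality rules out the empty set afterwards. *)
pose P (A : set V) := [/\ forall a x y, A x -> A y -> A (a *: x + y),
  forall u x, u \in U -> A x -> A (u + x) & forall x, A x -> x \in N -> x = 0].
have [F FP Ftot|A [[AL AU AN] Amax]] := @Zorn_bigcup V P.
  split.
  - move=> a x y [X FX Xx] [Y FY Yy]; have [XL _ _] := FP _ FX.
    have [YL _ _] := FP _ FY.
    case: (Ftot _ _ FX FY) => [XY|YX].
      by exists Y => //; apply: YL => //; exact: XY.
    by exists X => //; apply: XL => //; exact: YX.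
  - by move=> u x uU [X FX Xx]; exists X => //; have [_ XU _] := FP _ FX; exact: XU.
  - by move=> x [X FX Xx]; have [_ _ XN] := FP _ FX; exact: XN.
have A0 : A 0.
  apply: contrapT => nA0.
  have nA x : ~ A x.
    by move=> Ax; apply: nA0; have := AL (-1) x x Ax Ax; rewrite scaleN1r addNr.
  apply: (Amax (fun x => is_true (x \in U))).
    split; first by move=> x /nA.
    by move=> /(_ 0 (rpred0 U))/nA.
  split=> [a x y xU yU|u x uU xU|x xU xN] /=.
  - by rewrite rpredD ?rpredZ.
  - by rewrite rpredD.
  - exact: UN0.
have AD x y : A x -> A y -> A (x + y) by rewrite -{2}(scale1r x); exact: AL.
have AZ a x : A x -> A (a *: x).
  by move=> Ax; rewrite -[_ *: _]addr0; exact: AL.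
have cover x : exists n, n \in N /\ A (x - n).
  have [xA|xA] := EM (exists a n, [/\ a != 0, n \in N & A (a *: x - n)]).
    have [a [n [a0 nN An]]] := xA.
    exists (a^-1 *: n); split; first by rewrite rpredZ.
    have := AZ a^-1 _ An.
    by rewrite scalerBr scalerA mulVf // scale1r.
  exists 0; rewrite rpred0 subr0; split=> //; apply: contrapT => nAx.
  (* Adjoining [x] to [A] keeps the intersection with [N] trivial, since no nonzero multiple of [x]
     lies in [A] + [N]; this contradicts maximality. *)
  apply: (Amax (fun y => exists a z, A z /\ y = a *: x + z)).
    split; last by move=> /(_ x) /(_ _)/nAx; apply; exists 1, 0;
      rewrite scale1r addr0.
    by move=> y Ay; exists 0, y; rewrite scale0r add0r.
  split.
  - move=> a _ _ [b [z [Az ->]]] [c [y [Ay ->]]].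
    exists (a * b + c), (a *: z + y); split; first exact: AL.
    by rewrite scalerDl scalerDr scalerA addrACA.
  - move=> u _ uU [b [z [Az ->]]]; exists b, (u + z); split; first exact: AU.
    by rewrite addrCA.
  - move=> _ [b [z [Az ->]]] bN.
    have [b0|b0] := eqVneq b 0.
      by move: bN; rewrite b0 scale0r add0r; exact: AN.
    case: xA; exists b, (b *: x + z); split=> //.
    rewrite opprD addrA subrr add0r -scaleN1r; exact: AZ.
have [p pP] := choice cover.
have puniq x n : n \in N -> A (x - n) -> p x = n.
  move=> nN An; have [pN Ap] := pP x.
  apply/eqP; rewrite -subr_eq0; apply/eqP/AN; last by rewrite rpredB.
  have -> : p x - n = -1 *: (x - p x) + (x - n).
    by rewrite scaleN1r opprB addrA subrK.
  exact: AL.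
exists p; split=> [a x y|x|x xN|x xU].
- have [[xN Ax] [yN Ay]] := (pP x, pP y).
  apply: puniq; first by rewrite rpredD ?rpredZ.
  have -> : a *: x + y - (a *: p x + p y) = a *: (x - p x) + (y - p y).
    by rewrite scalerBr opprD addrACA.
  exact: AL.
- by have [] := pP x.
- by apply: puniq; [exact: xN|rewrite subrr].
- by apply: puniq; [exact: rpred0|rewrite subr0 -[x]addr0; exact: AU].
Qed.

(** The coordinate at [w] of the projection onto the line of [w] along a complement containing
    [U]. *)
Lemma functional_exists V (U : subspace V) (w : V) : w \notin U ->
  exists f : V -> k^o, [/\ linear f, f w = 1 & forall x, x \in U -> f x = 0].
Proof.
move=> wU.
have w0 : w != 0 by apply: contraNneq wU => ->; rewrite rpred0.
have [||N NP] := @subspace_of V (fun x => exists a, x = a *: w).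
- by exists 0; rewrite scale0r.
- by move=> a _ _ [b ->] [c ->]; exists (a * b + c); rewrite scalerDl scalerA.
have [x xU /NP[a xE]|p [pl pN pid pU]] := @complement_exists V U N.
  have [a0|a0] := eqVneq a 0; first by rewrite xE a0 scale0r.
  case/negP: wU; have -> : w = a^-1 *: x by rewrite xE scalerA mulVf // scale1r.
  by rewrite rpredZ.
have [f fP] := choice (fun x => (NP (p x)).1 (pN x)).
have finj a b : a *: w = b *: w -> a = b.
  move=> /eqP; rewrite -subr_eq0 -scalerBl scaler_eq0 (negPf w0) orbF subr_eq0.
  by move/eqP.
exists f; split=> [a x y||x xU].
- by apply: finj; rewrite -fP pl !fP scalerDl scalerA.
- by apply: finj; rewrite -fP scale1r pid //; apply/NP; exists 1; rewrite scale1r.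
- by apply: finj; rewrite -fP scale0r pU.
Qed.

Lemma linear_left_inverse V W (f : V -> W) : linear f -> injective f ->
  exists g : W -> V, linear g /\ cancel f g.
Proof.
move=> fl finj.
have [||N NP] := @subspace_of W (fun y => exists x, y = f x).
- by exists 0; rewrite (linear_fun0 fl).
- by move=> a _ _ [x ->] [y ->]; exists (a *: x + y); rewrite fl.
have [||Z ZP] := @subspace_of W (fun y => y = 0) => //.
  by move=> a _ _ -> ->; rewrite scaler0 addr0.
have [x /ZP -> //|p [pl pN pid _]] := @complement_exists W Z N.
have [g gP] := choice (fun y => (NP (p y)).1 (pN y)).
exists g; split=> [a x y|x]; apply: finj; first by rewrite -gP pl !gP fl.
by rewrite -gP pid //; apply/NP; exists x.
Qed.

(** Lifts to [U] of generators of its image, together with [s], span [U]. *)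
Lemma finite_dimensional_ker_im V W (f : V -> W) (s : seq V) (t : seq W) (U : subspace V) :
  linear f ->
  (forall x, x \in U -> f x = 0 -> x \in span (fun v => v \in s)) ->
  (forall x, x \in U -> f x \in span (fun w => w \in t)) ->
  exists r : seq V, forall x, x \in U -> x \in span (fun v => v \in r).
Proof.
move=> fl Us Ut.
have [||N NP] := @subspace_of W (fun y => exists2 x, x \in U & y = f x).
- by exists 0; rewrite ?rpred0 // (linear_fun0 fl).
- by move=> a _ _ [x ? ->] [y ? ->]; exists (a *: x + y); rewrite ?fl ?rpredD ?rpredZ.
have [y /NP[x xU ->]|r [rN _ _]] := @subspace_spans W t N; first exact: Ut.
have [q qU] : exists q : seq V, (forall x, x \in q -> x \in U) /\
    forall y, y \in span (fun w => w \in r) ->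
    exists2 x, x \in span (fun v => v \in q) & y = f x.
  have : forall y, y \in r -> exists2 x, x \in U & y = f x.
    by move=> y yr; apply/NP/rN/mem_span.
  elim: (r) => [_|w r' IHr rU].
    exists [::]; split=> // y /span_nil ->; exists 0; rewrite ?rpred0 //.
    by rewrite (linear_fun0 fl).
  have [y yr|q [qU qP]] := IHr; first by apply: rU; rewrite inE yr orbT.
  have [x xU wE] := rU w (mem_head _ _).
  exists (x :: q); split=> [y|y /span_cons[a [z [/qP[v vq ->] ->]]]].
    by rewrite inE => /orP[/eqP -> //|/qU].
  by exists (a *: x + v); rewrite ?fl ?wE //; apply/span_cons; exists a, v.
case: qU => qU qP.
exists (q ++ s) => x xU.
have [|v vq fE] := qP (f x); first by apply/rN/NP; exists x.
rewrite -(subrK v x); apply: rpredD.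
  apply: (@span_sub _ _ (fun v => v \in s)) => [y ys|].
    by apply: mem_span; rewrite mem_cat ys orbT.
  apply: Us; last by rewrite (linear_funB fl) fE subrr.
  by rewrite rpredB //; apply: span_sub vq.
by apply: span_sub vq => y yq; apply: mem_span; rewrite mem_cat yq.
Qed.

End LinearAlgebra.

(** * Tensors and functionals *)

Section Slice.
Variable k : fieldType.
Implicit Types V W : lmodType k.

(** The map id ⊗ [f], with [V] ⊗ k identified with [V]. *)
Definition slice V W (f : W -> k^o) (t : tensor V W) : V :=
  tensor_lift (fun v w => (f w : k) *: v) t.

Section Theory.
Variables (V W : lmodType k) (f : W -> k^o) (fl : linear f).

Lemma slice_bilinear : is_bilinear (fun (v : V) (w : W) => (f w : k) *: v).
Proof.
split=> [v a w w'|w a v v']; first by rewrite fl scalerDl scalerA.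
by rewrite scalerDr !scalerA mulrC.
Qed.

Lemma slice_linear : linear (@slice V W f).
Proof. exact: tensor_lift_linear slice_bilinear. Qed.

Lemma slice_tens (v : V) (w : W) : slice f (tens v w) = (f w : k) *: v.
Proof. exact: (tensor_liftE slice_bilinear). Qed.

End Theory.

Lemma slice_map V W V' W' (g : V -> V') (h : W -> W') (f : W' -> k^o) t :
  linear g -> linear h -> linear f ->
  slice f (tensor_map g h t) = g (slice (f \o h) t).
Proof.
move=> gl hl fl; have fhl : linear (f \o h) by move=> a x y; rewrite /= hl fl.
have ml := tensor_map_linear gl hl.
apply: (@tensor_ext k V W V' (slice f \o tensor_map g h) (g \o slice (f \o h))).
- by move=> a x y; rewrite /= ml (slice_linear fl).
- by move=> a x y; rewrite /= (slice_linear fhl) gl.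
move=> v w; rewrite /= tensor_mapE // !slice_tens //=.
by rewrite (linear_funZ gl).
Qed.

Lemma tensor_map_comp V W V' W' V'' W'' (g : V -> V') (h : W -> W')
    (g' : V' -> V'') (h' : W' -> W'') t :
  linear g -> linear h -> linear g' -> linear h' ->
  tensor_map g' h' (tensor_map g h t) = tensor_map (g' \o g) (h' \o h) t.
Proof.
move=> gl hl gl' hl'.
have ggl : linear (g' \o g) by move=> a x y; rewrite /= gl gl'.
have hhl : linear (h' \o h) by move=> a x y; rewrite /= hl hl'.
have [l1 l2] := (tensor_map_linear gl hl, tensor_map_linear gl' hl').
apply: (@tensor_ext k V W _ (tensor_map g' h' \o tensor_map g h)).
- by move=> a x y; rewrite /= l1 l2.
- exact: tensor_map_linear.
by move=> v w; rewrite /= !tensor_mapE.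
Qed.

Lemma tensor_map_id V W (t : tensor V W) : tensor_map id id t = t.
Proof.
apply: (@tensor_ext k V W _ _ id) => //; first exact: tensor_map_linear.
by move=> v w; rewrite tensor_mapE.
Qed.

Definition tensor_sub V W (N : subspace V) : subspace (tensor V W) :=
  span (fun t => exists n c, n \in N /\ t = tens n c).

Lemma slice_tensor_sub V W (N : subspace V) (f : W -> k^o) t : linear f ->
  t \in tensor_sub W N -> slice f t \in N.
Proof.
move=> fl; have sl := @slice_linear V W f fl.
have [||Z ZP] := @subspace_of _ (tensor V W) (fun t => slice f t \in N).
- by rewrite (linear_fun0 sl) rpred0.
- by move=> a u v uN vN; rewrite sl rpredD ?rpredZ.
move=> tN; apply/ZP; apply: span_sub tN => _ [n [c [nN ->]]].
by apply/ZP; rewrite slice_tens ?rpredZ.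
Qed.

(* Induction on the number of terms of [t]: the last one is either redundant,
   or singled out by a functional vanishing on the other right factors. *)
Lemma tensor_subP V W (N : subspace V) t :
  (forall f : W -> k^o, linear f -> slice f t \in N) -> t \in tensor_sub W N.
Proof.
have tens0 (v : V) : tens v 0 = 0 :> tensor V W.
  exact: (linear_fun0 (tens_linearr v)).
have [s] : exists s : seq (V * W), t = \sum_(p <- s) tens p.1 p.2.
  elim/tensor_ind: t => [|a v w _ [s ->]]; first by exists [::]; rewrite big_nil.
  exists ((a *: v, w) :: s); rewrite big_cons /=; congr (_ + _).
  by rewrite (linear_funZ (tens_linearl w)).
elim: {s}(size s) {-2}s (leqnn (size s)) t => [|n IHn] [|[v w] s] //.
- by move=> _ t -> _; rewrite big_nil; exact: rpred0.
- by move=> _ t -> _; rewrite big_nil; exact: rpred0.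
rewrite [size _]/= ltnS => sn t; rewrite big_cons [(v, w).1]/= [(v, w).2]/= => tE tN.
have [ws|ws] := boolP (w \in span (fun x => x \in [seq p.2 | p <- s])).
  suff [s' [s's s'E]] : exists s' : seq (V * W), size s' = size s /\
      tens v w + \sum_(p <- s) tens p.1 p.2 = \sum_(p <- s') tens p.1 p.2.
    by apply: (IHn s' _ t _ tN); [rewrite s's|rewrite tE].
  elim: (s) w ws {tE} => [|[x y] r IHr] w /= => [/span_nil ->|].
    by exists [::]; rewrite tens0 add0r.
  move=> /span_cons[a [z [/IHr[r' [r's r'E]] ->]]].
  exists ((a *: v + x, y) :: r'); rewrite /= r's; split=> //.
  rewrite !big_cons /= -r'E tens_linearl tens_linearr -!addrA; congr (_ + _).
  by rewrite addrCA.
have [f [fl fw fs]] := functional_exists ws.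
have sl := @slice_linear V W f fl.
have sum0 : slice f (\sum_(p <- s) tens p.1 p.2) = 0.
  have : forall p, p \in s -> f p.2 = 0.
    by move=> p ps; apply/fs/mem_span/map_f.
  elim: (s) => [_|p r IHr rs]; first by rewrite big_nil (linear_fun0 sl).
  rewrite big_cons (linear_funD sl) IHr; last first.
    by move=> q qr; apply: rs; rewrite inE qr orbT.
  by rewrite slice_tens // rs ?mem_head // scale0r addr0.
have vN : v \in N.
  have := tN f fl; rewrite tE (linear_funD sl) sum0 addr0 slice_tens // fw.
  by rewrite scale1r.
have vwN : tens v w \in tensor_sub W N by apply: mem_span; exists v, w.
rewrite tE; apply: rpredD => //; apply: IHn sn _ erefl _ => g gl.
have -> : \sum_(p <- s) tens p.1 p.2 = t - tens v w by rewrite tE addrC addKr.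
rewrite (linear_funB (slice_linear gl)); apply: rpredB; first exact: tN.
exact: slice_tensor_sub.
Qed.

(** [tensor_subP] for the zero subspace, applied to the difference. *)
Lemma tensor_slice_eq V W (t u : tensor V W) :
  (forall f : W -> k^o, linear f -> slice f t = slice f u) -> t = u.
Proof.
move=> tu.
have [||Z ZP] := @subspace_of k V (fun v => v = 0) => //.
  by move=> a _ _ -> ->; rewrite scaler0 addr0.
have : t - u \in tensor_sub W Z.
  apply: tensor_subP => f fl; apply/ZP.
  by rewrite (linear_funB (slice_linear fl)) tu // subrr.
have [||Z' ZP'] := @subspace_of k (tensor V W) (fun v => v = 0) => //.
  by move=> a _ _ -> ->; rewrite scaler0 addr0.
move=> tuZ; apply/eqP; rewrite -subr_eq0; apply/eqP/ZP'.
apply: span_sub tuZ => _ [v [w [/ZP -> ->]]]; apply/ZP'.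
exact: (linear_fun0 (tens_linearl w)).
Qed.

(** The left factors of any expression of [t] span all its slices. Local finiteness of comodules
    comes from here. *)
Lemma slice_finite V W (t : tensor V W) :
  exists s : seq V, forall f : W -> k^o, linear f ->
    slice f t \in span (fun v => v \in s).
Proof.
elim/tensor_ind: t => [|a v w t [s sP]].
  by exists [::] => f fl; rewrite (linear_fun0 (slice_linear fl)) rpred0.
exists (v :: s) => f fl; rewrite slice_linear // slice_tens //.
by apply/span_cons; exists (a * f w), (slice f t); rewrite scalerA; split; first exact: sP.
Qed.

End Slice.

(** * Comodules as modules over the dual algebra *)

Section Action.
Variables (k : fieldType) (C : coalgebra k).
Implicit Types M N P : comodule C.

(* The left action on [M] of the dual algebra of [C]. *)
Definition act M (f : C -> k^o) (x : M) : M := slice f (coact x).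

Lemma act_linear M (f : C -> k^o) : linear f -> linear (@act M f).
Proof. by move=> fl a x y; rewrite /act linearP slice_linear. Qed.

Lemma counit_linear : linear (counit : C -> k^o).
Proof. by move=> a x y; rewrite linearP. Qed.

Lemma act_counit M (x : M) : act (counit : C -> k^o) x = x.
Proof. exact: coact_counit. Qed.

(** By coassociativity the composite is the action of the convolution product c ↦ Σ [g](c₁) [f](c₂);
    the functional [h'] is [g] ⊗ [f] on [C] ⊗ [C]. *)
Lemma act_act M (f g : C -> k^o) : linear f -> linear g ->
  exists2 h : C -> k^o, linear h & forall x : M, act g (act f x) = act h x.
Proof.
move=> fl gl.
have idl (V : lmodType k) : linear (id : V -> V) by [].
have cl : linear (coact : M -> tensor M C) by move=> a u v; rewrite linearP.
have Dl : linear (comult : C -> tensor C C) by move=> a u v; rewrite linearP.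
pose h' : tensor C C -> k^o := tensor_lift (fun a b => (f b : k) * g a : k^o).
have hb : is_bilinear (fun a b : C => (f b : k) * g a : k^o).
  split=> [v a x y|v a x y]; first by rewrite fl mulrDl -mulrA.
  by rewrite gl mulrDr mulrCA.
have hl' : linear h' by exact: tensor_lift_linear.
have hl : linear (h' \o comult) by move=> a x y; rewrite /= Dl hl'.
exists (h' \o comult) => // x; rewrite /act.
have sf := @slice_linear k (tensor M C) C f fl.
have sg := @slice_linear k M C g gl.
have -> : coact (slice f (coact x)) = slice f (tensor_map coact id (coact x)).
  by rewrite slice_map.
transitivity (slice h' (tensor_assoc (tensor_map coact id (coact x)))); last first.
  by rewrite coactA slice_map.
have al := @tensor_assoc_linear k M C C.
have sh := @slice_linear k M (tensor C C) h' hl'.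
move: (tensor_map _ _ _).
apply: (@tensor_ext k (tensor M C) C _ (slice g \o slice f)
  (slice h' \o (@tensor_assoc k M C C))).
- by move=> a u v; rewrite /= sf sg.
- by move=> a u v; rewrite /= al sh.
move=> t c /=; rewrite slice_tens // (linear_funZ sg).
move: t; apply: (@tensor_ext k M C _ (fun t => (f c : k) *: slice g t)
  (fun t => slice h' (tensor_assoc (tens t c)))) => [a u v|a u v|m b].
- by rewrite sg scalerDr !scalerA mulrC.
- by rewrite (tens_linearl c) al sh.
by rewrite tensor_assocE !slice_tens // scalerA /h' tensor_liftE.
Qed.

Lemma com_act M N (F : Com M N) (f : C -> k^o) x :
  linear f -> F (act f x) = act f (F x).
Proof.
move=> fl; have [Fl Fc] := comP F.
by rewrite /act Fc slice_map.
Qed.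

(** The hypothesis says that both sides of the comodule identity have the same slices, and slices
    separate tensors. *)
Lemma com_of M N (F : M -> N) : linear F ->
  (forall (f : C -> k^o) x, linear f -> F (act f x) = act f (F x)) ->
  exists G : Com M N, forall x, G x = F x.
Proof.
move=> Fl Fa.
suff FP : comodule_morphism_pred F by exists (MkCom FP).
apply/asboolP; split=> // m; apply: tensor_slice_eq => f fl.
by rewrite slice_map //; symmetry; exact: Fa.
Qed.

Lemma subcomodule_act M (N : subcomodule M) (f : C -> k^o) x :
  linear f -> x \in N -> act f x \in N.
Proof.
move=> fl /(subcomod_coact (s := N)); exact: slice_tensor_sub.
Qed.

Lemma subcomodule_of M (P : M -> Prop) :
  P 0 -> (forall a u v, P u -> P v -> P (a *: u + v)) ->
  (forall (f : C -> k^o) x, linear f -> P x -> P (act f x)) ->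
  exists N : subcomodule M, forall x, x \in N <-> P x.
Proof.
move=> P0 PD Pa; have [N NP] := subspace_of P0 PD.
have Nc x : x \in N -> coact x \in tensor_sub C N.
  by move=> /NP Px; apply: tensor_subP => f fl; apply/NP/Pa.
by exists (Subcomodule Nc).
Qed.

Lemma ker_subcomodule M N (F : Com M N) :
  exists K : subcomodule M, forall x, x \in K <-> F x = 0.
Proof.
have Fl := (comP F).1; apply: subcomodule_of => [|a u v u0 v0|f x fl x0].
- exact: linear_fun0.
- by rewrite Fl u0 v0 scaler0 addr0.
- by rewrite com_act // x0 (linear_fun0 (act_linear fl)).
Qed.

Lemma im_subcomodule M N (F : Com M N) :
  exists K : subcomodule N, forall y, y \in K <-> exists x, y = F x.
Proof.
have Fl := (comP F).1.
apply: subcomodule_of => [|a _ _ [u ->] [v ->]|f _ fl [x ->]].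
- by exists 0; rewrite linear_fun0.
- by exists (a *: u + v); rewrite Fl.
- by exists (act f x); rewrite com_act.
Qed.

(** The orbit of [x] under the dual algebra: it is stable by [act_act], contains [x] because the
    counit acts as the identity, and is finite-dimensional by [slice_finite]. *)
Lemma cyclic_subcomodule M (x : M) :
  exists N : subcomodule M, [/\ x \in N,
    exists s : seq M, forall y, y \in N -> y \in span (fun v => v \in s)
    & forall N' : subcomodule M, x \in N' -> forall y, y \in N -> y \in N'].
Proof.
pose A (y : M) := exists2 f : C -> k^o, linear f & y = act f x.
have [|a u v|f y fl|N NP] := @subcomodule_of M (fun y => y \in span A).
- exact: rpred0.
- by move=> uA vA; apply: rpredD => //; exact: rpredZ.
- have [||Z ZP] := @subspace_of k M (fun y => act f y \in span A).
  + by rewrite (linear_fun0 (act_linear fl)); exact: rpred0.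
  + move=> a u v uA vA; rewrite (act_linear fl).
    by apply: rpredD => //; exact: rpredZ.
  move=> yA; apply/ZP; apply: span_sub yA => _ [g gl ->]; apply/ZP.
  by have [h hl ->] := @act_act M g f gl fl; apply: mem_span; exists h.
exists N; split=> [||N' xN' y /NP yA].
- by apply/NP/mem_span; exists (counit : C -> k^o); rewrite ?act_counit //;
    exact: counit_linear.
- have [s sP] := slice_finite (coact x).
  exists s => y /NP; apply: span_sub => _ [f fl ->]; exact: sP.
- by apply: span_sub yA => _ [f fl ->]; exact: subcomodule_act.
Qed.

End Action.

(** * Subcomodules as comodules *)

Lemma tensor_assoc_natural (k : fieldType) (U U' V W : lmodType k) (f : U -> U')
    (t : tensor (tensor U V) W) : linear f ->
  tensor_assoc (tensor_map (tensor_map f id) id t) = tensor_map f id (tensor_assoc t).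
Proof.
move=> fl; have idl (Z : lmodType k) : linear (id : Z -> Z) by [].
have l1 := tensor_map_linear fl (idl V).
have l2 := tensor_map_linear l1 (idl W).
have l3 := tensor_map_linear fl (idl (tensor V W)).
have assl (X : lmodType k) := @tensor_assoc_linear k X V W.
move: t; apply: (@tensor_ext k (tensor U V) W _
  (fun t => tensor_assoc (tensor_map (tensor_map f id) id t))
  (fun t => tensor_map f id (tensor_assoc t))) => [a u v|a u v|t w].
- by rewrite l2 assl.
- by rewrite assl l3.
rewrite tensor_mapE //; move: t.
apply: (@tensor_ext k U V _
  (fun t => tensor_assoc (tens (tensor_map f id t) w))
  (fun t => tensor_map f id (tensor_assoc (tens t w)))) => [a u v|a u v|u v].
- by rewrite l1 (tens_linearl w) assl.
- by rewrite (tens_linearl w) assl l3.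
by rewrite tensor_mapE // !tensor_assocE tensor_mapE.
Qed.

Section SubcomoduleObject.
Variables (k : fieldType) (C : coalgebra k) (M : comodule C) (N : subcomodule M).

Record sub_carrier := SubCarrier {
  sub_val :> M;
  sub_valP : subspace_pred N sub_val
}.
HB.instance Definition _ := [isSub for sub_val].
HB.instance Definition _ := [Choice of sub_carrier by <:].
HB.instance Definition _ := [SubChoice_isSubLmodule of sub_carrier by <:].

Lemma sub_val_linear : linear (sub_val : sub_carrier -> M).
Proof. by []. Qed.

Lemma sub_val_inj : injective (sub_val : sub_carrier -> M).
Proof. exact: val_inj. Qed.

(** The coaction is that of [M] followed by a linear retraction [r] of the inclusion. Tensoring with
    [r] shows that the inclusion remains injective after tensoring, so coassociativity can be
    checked inside the tensor product with [M]. *)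
Lemma subcomodule_object :
  exists (S : comodule C) (i : Com S M),
    injective i /\ forall x, x \in N <-> exists y, x = i y.
Proof.
have [r [rl rK]] := linear_left_inverse sub_val_linear sub_val_inj.
have idl (V : lmodType k) : linear (id : V -> V) by [].
have cl : linear (coact : M -> tensor M C) by move=> a u v; rewrite linearP.
have Dl : linear (comult : C -> tensor C C) by move=> a u v; rewrite linearP.
have vl := sub_val_linear.
have ml (W : lmodType k) := tensor_map_linear rl (idl W).
have mv (W : lmodType k) := tensor_map_linear vl (idl W).
have mK (W : lmodType k) : cancel (tensor_map sub_val (id : W -> W)) (tensor_map r id).
  move=> t; rewrite tensor_map_comp // -[RHS]tensor_map_id; congr (tensor_map _ _ _).
  exact/funext.
pose c (x : sub_carrier) : tensor sub_carrier C := tensor_map r id (coact (sub_val x)).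
(* Retracting and including again is the identity on the image of [N] ⊗ [C], where the coaction of
   an element of [N] lies. *)
have cP x : tensor_map sub_val id (c x) = coact (sub_val x).
  rewrite /c; have xN : sub_val x \in (N : subspace M) by exact: sub_valP.
  have [||Z ZP] := @subspace_of k (tensor M C)
    (fun t => tensor_map sub_val id (tensor_map r (id : C -> C) t) = t).
  - by rewrite (linear_fun0 (ml C)) (linear_fun0 (mv C)).
  - by move=> a u v uE vE; rewrite ml mv uE vE.
  apply/ZP; apply: span_sub (subcomod_coact xN) => _ [n [d [nN ->]]]; apply/ZP.
  by rewrite !tensor_mapE // -[n]/(sub_val (SubCarrier nN)) rK.
have ccl : linear c by move=> a x y; rewrite /c vl cl ml.
pose hl := GRing.isLinear.Build k sub_carrier (tensor sub_carrier C) *:%R c ccl.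
pose cc : {linear sub_carrier -> tensor sub_carrier C} := HB.pack c hl.
have ccl' : linear cc by exact: ccl.
have cA x : tensor_assoc (tensor_map cc id (cc x)) = tensor_map id comult (cc x).
  rewrite -[LHS]mK -[RHS]mK; congr (tensor_map _ _ _).
  rewrite -tensor_assoc_natural //.
  have -> : tensor_map sub_val id (tensor_map id comult (cc x)) =
      tensor_map id comult (tensor_map sub_val id (cc x)).
    by rewrite !tensor_map_comp.
  rewrite [tensor_map _ _ (cc x) in RHS]cP -coactA -cP; congr tensor_assoc.
  have mvC := mv C; rewrite [LHS]tensor_map_comp // [RHS]tensor_map_comp //.
  by congr (tensor_map _ _ _); apply/funext => y; exact: cP.
have cu z : tensor_lift (fun y (d : C) => (counit d : k) *: y) (cc z) = z.
  apply: sub_val_inj; rewrite -[RHS]act_counit /act -cP.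
  by rewrite slice_map //; exact: counit_linear.
pose S := Comodule cA cu.
have vP : comodule_morphism_pred (sub_val : S -> M).
  by apply/asboolP; split=> // x; rewrite -cP.
exists S, (MkCom vP); split; first exact: sub_val_inj.
move=> x; split=> [xN|[y ->]]; first by exists (SubCarrier xN).
exact: sub_valP.
Qed.

End SubcomoduleObject.

(** * Exactness *)

Section AbelianCategory.
Variable A : preadditive.

Lemma mcomp0 (X Y Z : A) (f : hom X Y) : (0 : hom Y Z) ** f = 0.
Proof. by apply: (addrI ((0 : hom Y Z) ** f)); rewrite -mcompDl !addr0. Qed.

Lemma mcompr0 (X Y Z : A) (g : hom Y Z) : g ** (0 : hom X Y) = 0.
Proof. by apply: (addrI (g ** (0 : hom X Y))); rewrite -mcompDr !addr0. Qed.

Lemma kernel_mono (K X Y : A) (i : hom K X) (f : hom X Y) : is_kernel i f -> mono i.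
Proof.
case=> fi0 ker W g h gh.
have [|z [_ zU]] := ker W (i ** g); first by rewrite mcompA fi0 mcomp0.
by rewrite -(zU g) // -(zU h).
Qed.

Lemma cokernel_epi (X Y Q : A) (p : hom Y Q) (f : hom X Y) : is_cokernel p f -> epi p.
Proof.
case=> pf0 coker W g h gh.
have [|z [_ zU]] := coker W (g ** p); first by rewrite -mcompA pf0 mcompr0.
by rewrite -(zU g) // -(zU h).
Qed.

(** By normality [m] is the kernel of some [g], and [g] factors through [q], so whatever [q] kills
    is killed by [g]. *)
Lemma mono_is_kernel (X Y Q : A) (m : hom X Y) (q : hom Y Q) :
  abelian A -> mono m -> is_cokernel q m -> is_kernel m q.
Proof.
move=> abA /(abelian_normal abA)[Z [g [gm0 ker]]] [qm0 coker].
split=> // W f qf0; apply: ker.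
have [h [<- _]] := coker Z g gm0.
by rewrite -mcompA qf0 mcompr0.
Qed.

Lemma epi_is_cokernel (K X Y : A) (i : hom K X) (p : hom X Y) :
  abelian A -> epi p -> is_kernel i p -> is_cokernel p i.
Proof.
move=> abA /(abelian_conormal abA)[W [g [pg0 coker]]] [pi0 ker].
split=> // Z f fi0; apply: coker.
have [h [<- _]] := ker W g pg0.
by rewrite mcompA fi0 mcomp0.
Qed.

Lemma iso_mono (X Y : A) (f : hom X Y) : is_iso f -> mono f.
Proof.
move=> [g [gf _]] W u v fuv.
by rewrite -[u]mcomp1m -[v]mcomp1m -gf -!mcompA fuv.
Qed.

Lemma mono_comp (X Y Z : A) (g : hom Y Z) (f : hom X Y) :
  mono g -> mono f -> mono (g ** f).
Proof. by move=> gm fm W u v; rewrite -!mcompA => /gm/fm. Qed.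

Lemma is_zeroP (Z X : A) (f g : hom Z X) : is_zero Z -> f = g.
Proof. by move=> Z0; rewrite -[f]mcompm1 -[g]mcompm1 Z0 !mcompr0. Qed.

Lemma mono_zero (X Y : A) : mono (0 : hom X Y) -> is_zero X.
Proof. by apply; rewrite mcompr0 mcomp0. Qed.

End AbelianCategory.

Lemma fmap0 (A B : preadditive) (T : functor A B) (X Y : A) : additive_functor T ->
  fmap T (0 : hom X Y) = 0.
Proof.
by move=> Tadd; apply: (addrI (fmap T (0 : hom X Y))); rewrite -Tadd !addr0.
Qed.

(** * Short exact sequences of comodules and exact functors on them *)

Section ComoduleCategory.
Variables (k : fieldType) (C : coalgebra k).
Local Notation Comod := (comod_category C).
Implicit Types M N P : comodule C.

Lemma com0 M N (F : Com M N) : F 0 = 0.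
Proof. exact: linear_fun0 (comP F).1. Qed.

Lemma com_inj M N (F : Com M N) : (forall x, F x = 0 -> x = 0) -> injective F.
Proof.
move=> F0 x y Fxy; apply/eqP; rewrite -subr_eq0; apply/eqP/F0.
by rewrite (linear_funB (comP F).1) Fxy subrr.
Qed.

Lemma com_lift M N P (u : Com M N) (g : Com P N) : injective u ->
  (forall z, exists x, g z = u x) -> exists h : Com P M, com_comp u h = g.
Proof.
move=> uinj /choice[h hP]; have [ul _] := comP u; have [gl _] := comP g.
have [a x y|f x fl|H HE] := @com_of _ _ P M h.
- by apply: uinj; rewrite ul -!hP gl.
- by apply: uinj; rewrite com_act // -!hP com_act.
by exists H; apply: com_eq => x; rewrite /= HE hP.
Qed.

Lemma com_factor M N P (p : Com M N) (g : Com M P) : (forall y, exists x, y = p x) ->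
  (forall x, p x = 0 -> g x = 0) -> exists h : Com N P, com_comp h p = g.
Proof.
move=> /choice[s sP] pg; have [pl _] := comP p; have [gl _] := comP g.
have sp x : g (s (p x)) = g x.
  apply/eqP; rewrite -subr_eq0 -(linear_funB gl); apply/eqP/pg.
  by rewrite (linear_funB pl) -sP subrr.
have [a x y|f x fl|H HE] := @com_of _ _ N P (g \o s).
- by rewrite /= {1}(sP x) {1}(sP y) -pl sp gl.
- by rewrite /= {1}(sP x) -com_act // sp com_act.
by exists H; apply: com_eq => x; rewrite /= HE /= sp.
Qed.

Lemma com_short_exact M N P (u : Com M N) (p : Com N P) : injective u ->
  (forall y, exists x, y = p x) -> (forall y, p y = 0 <-> exists x, y = u x) ->
  @short_exact Comod M N P u p.
Proof.
move=> uinj psurj pu; split; split.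
- by apply: com_eq => x; apply/pu; exists x.
- move=> W g pg0; have [z|h hE] := com_lift (g := g) uinj.
    by apply/pu; have := congr1 (fun F : Com W P => F z) pg0.
  exists h; split=> // h' /= h'E; apply: com_eq => x; apply: uinj.
  by have := congr1 (fun F : Com W N => F x) (etrans hE (esym h'E)).
- by apply: com_eq => x; apply/pu; exists x.
- move=> W g gu0; have [x /pu[y ->]|h hE] := com_factor (g := g) psurj.
    by have := congr1 (fun F : Com M W => F y) gu0.
  exists h; split=> // h' /= h'E; apply: com_eq => y; have [x ->] := psurj y.
  by have := congr1 (fun F : Com N W => F x) (etrans hE (esym h'E)).
Qed.

Lemma quotient_map M (N : subcomodule M) :
  exists p : Com M (quotient_comodule N),
    (forall y, exists x, y = p x) /\ forall x, p x = 0 <-> x \in N.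
Proof.
have pP : comodule_morphism_pred (qproj N : M -> quotient_comodule N).
  apply/asboolP; split=> [a x y|m]; first exact: linearP.
  exact: quotient_coactE.
exists (MkCom pP); split=> [y|x]; last exact: qproj0.
by exists (qrepr y); rewrite /= qreprK.
Qed.

Section Exact.
Variables (B : preadditive) (T : functor Comod B) (Tex : exact_functor T).

(** An injection sits in a short exact sequence with the quotient by its image, and [T] preserves
    it. *)
Lemma fmap_mono M N (u : Com M N) : injective u -> mono (@fmap _ _ T M N u).
Proof.
move=> uinj; have [K KP] := im_subcomodule u.
have [p [psurj pK]] := quotient_map K.
have uE y : p y = 0 <-> exists x, y = u x by rewrite pK KP.
have [i _] := Tex.2 _ _ _ _ _ (com_short_exact uinj psurj uE).
exact: kernel_mono i.
Qed.

Lemma fmap_epi M N (p : Com M N) : (forall y, exists x, y = p x) ->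
  epi (@fmap _ _ T M N p).
Proof.
move=> psurj; have [K KP] := ker_subcomodule p.
have [S [i [iinj iK]]] := subcomodule_object K.
have pE y : p y = 0 <-> exists x, y = i x by rewrite -KP iK.
have [_ c] := Tex.2 _ _ _ _ _ (com_short_exact iinj psurj pE).
exact: cokernel_epi c.
Qed.

End Exact.
End ComoduleCategory.

(** * Simple comodules and socles *)

Lemma span_map (k : fieldType) (V W : lmodType k) (f : V -> W) (s : seq V) x : linear f ->
  x \in span (fun v => v \in s) -> f x \in span (fun w => w \in map f s).
Proof.
move=> fl; have [|a u v uP vP|N NP] :=
  @subspace_of k V (fun x => f x \in span (fun w => w \in map f s)).
- by rewrite (linear_fun0 fl); exact: rpred0.
- by rewrite fl; apply: rpredD => //; exact: rpredZ.
move=> xs; apply/NP; apply: span_sub xs => v vs; apply/NP/mem_span; exact: map_f.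
Qed.

Section Simple.
Variables (k : fieldType) (C : coalgebra k).
Implicit Types M N S X E : comodule C.

Lemma com_neq0 M N (F : Com M N) : F <> 0 -> exists x, F x <> 0.
Proof.
move=> F0; apply: contrapT => nF; apply: F0; apply: com_eq => x.
by apply: contrapT => Fx; apply: nF; exists x.
Qed.

Lemma simple_com_inj S N (F : Com S N) : simple_comodule S -> F <> 0 -> injective F.
Proof.
move=> [_ sS] /com_neq0[x Fx]; have [K KP] := ker_subcomodule F.
apply: com_inj => y /KP yK.
case: (sS K) => [K0|KT]; first exact: K0.
by case: Fx; apply/KP.
Qed.

Lemma simple_eval_inj S N (F : Com S N) x :
  simple_comodule S -> x <> 0 -> F x = 0 -> F = 0.
Proof.
move=> sS x0 Fx; apply: contrapT => /(simple_com_inj sS) Finj.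
by apply: x0; apply: Finj; rewrite com0.
Qed.

Lemma simple_finite S : simple_comodule S ->
  exists s : seq S, forall x, x \in span (fun v => v \in s).
Proof.
move=> [[x x0] sS]; have [N [xN [s sN] _]] := cyclic_subcomodule x.
exists s => y; apply: sN; case: (sS N) => [/(_ x xN)//|]; exact.
Qed.

(** A nonzero subcomodule of minimal dimension inside the finite-dimensional subcomodule generated
    by [x] is simple. *)
Lemma exists_simple M (N : subcomodule M) x : x \in N -> x <> 0 ->
  exists S (F : Com S M), [/\ simple_comodule S, injective F & forall y, F y \in N].
Proof.
move=> xN x0; have [N0 [xN0 [s sN0] N0N]] := cyclic_subcomodule x.
pose P (U : subspace M) := exists K : subcomodule M,
  [/\ forall y, y \in U <-> y \in K, forall y, y \in K -> y \in N &
    exists2 y, y \in K & y <> 0].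
have [|U [K [UK KN [z zK z0]]] Umin] := @minimal_subspace k M P s N0 _ sN0.
  by exists N0; split=> // [y|]; [exact: N0N|exists x].
have [S [i [iinj iK]]] := subcomodule_object K.
exists S, i; split=> [||y] //; last by apply/KN/iK; exists y.
split=> [|L].
  have /iK[y zE] := zK; exists y => y0; apply: z0; rewrite zE y0; exact: com0.
have [L0|/existsNP[y /not_implyP[yL y0]]] := EM (forall y, y \in L -> y = 0).
  by left.
right=> w; have il := (comP i).1.
have [|a _ _ [u uL ->] [v vL ->]|f _ fl [u uL ->]|L' L'P] :=
  @subcomodule_of k C M (fun v => exists2 u, u \in L & v = i u).
- by exists 0; rewrite ?rpred0 ?com0.
- by exists (a *: u + v); rewrite ?il // rpredD ?rpredZ.
- by exists (act f u); [exact: subcomodule_act|rewrite com_act].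
have iL' u : u \in L -> i u \in L' by move=> uL; apply/L'P; exists u.
have L'K v : v \in L' -> v \in K by move=> /L'P[u _ ->]; apply/iK; exists u.
have PL' : P L'.
  exists L'; split=> // [v /L'K/KN //|]; exists (i y); first exact: iL'.
  by rewrite -(com0 i) => /iinj.
have /L'P[u uL /iinj ->] // : i w \in L'.
by apply: (Umin _ PL') => [v /L'K/UK|]//; apply/UK/iK; exists w.
Qed.

(** The preimage under [f] of the image of [j] is a subcomodule of [X], nonzero because [j] is
    essential, hence all of [X]. *)
Lemma essential_simple S E X (j : Com S E) (f : Com X E) : simple_comodule X ->
  essential j -> f <> 0 -> forall x, exists s, f x = j s.
Proof.
move=> [_ sX] ess /com_neq0[x0 fx0]; have [K KP] := im_subcomodule f.
have [jl fl] := ((comP j).1, (comP f).1).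
have [|a u v [s us] [t vt]|h u hl [s us]|L LP] :=
  @subcomodule_of k C X (fun x => exists s, f x = j s).
- by exists 0; rewrite !com0.
- by exists (a *: s + t); rewrite jl fl us vt.
- by exists (act h s); rewrite !com_act // us.
move=> x; apply/LP; case: (sX L) => // L0; exfalso; apply: fx0.
apply: (ess K) => [s /KP[y jE]|]; last by apply/KP; exists x0.
have y0 : y = 0 by apply/L0/LP; exists s.
by rewrite jE y0 com0.
Qed.

(** The maps from [S] into [Xs n] form a descending chain of subspaces of a finite-dimensional
    space, so it stops at some [n0]. A map into [Xs n0] then lands in every [Xs n], hence vanishes;
    so [Xs n0] has no socle and is zero. *)
Lemma stationary_of_socle S X (Xs : nat -> subcomodule X) :
  finite_dimensional (Com S X) ->
  (forall n x, x \in Xs n.+1 -> x \in Xs n) ->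
  (forall x, (forall n, x \in Xs n) -> x = 0) ->
  (forall N : subcomodule X, (exists2 x, x \in N & x <> 0) ->
    exists2 g : Com S X, g <> 0 & forall s, g s \in N) ->
  exists n0, forall x, x \in Xs n0 -> x = 0.
Proof.
move=> [r rP] Xdec Xcap soc.
have Xle m n x : (m <= n)%N -> x \in Xs n -> x \in Xs m.
  by move=> /subnK <-; elim: (n - m)%N => // d IHd /Xdec.
have VE n : exists U : subspace (Com S X), forall g, g \in U <-> forall s, g s \in Xs n.
  apply: subspace_of => [s|a u v uX vX s] /=; first exact: rpred0.
  by apply: rpredD; [apply: rpredZ|].
pose P (U : subspace (Com S X)) := exists n, forall g, g \in U <-> forall s, g s \in Xs n.
have [U0 U0P] := VE 0%N.
have [||U [n0 UP] Umin] := @minimal_subspace k (Com S X) P r U0.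
- by exists 0%N.
- by move=> g _; exact: rP.
exists n0 => x xn0; apply: contrapT => x0.
have [|g g0 gn0] := soc (Xs n0); first by exists x.
apply: g0; apply: com_eq => s; apply: Xcap => n.
(* Minimality of [U] only compares it with smaller subspaces, hence an index beyond both [n] and
   [n0]. *)
have [U' U'P] := VE (maxn n n0).
apply: (@Xle _ (maxn n n0)); first exact: leq_maxl.
apply: (U'P g).1; apply: Umin; last exact: (UP g).2.
  by exists (maxn n n0).
by move=> h /U'P hU'; apply: (UP h).2 => t; apply: Xle (hU' t); exact: leq_maxr.
Qed.

Lemma socle_filtration S0 S E X (j0 : Com S0 E) (j : Com S E) :
  simple_comodule S0 -> simple_comodule S ->
  @injective_object (comod_category C) E -> essential j0 -> j <> 0 ->
  ~ finite_dimensional (Com S X) ->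
  exists Xs : nat -> subcomodule X,
    (forall n x, x \in Xs n.+1 -> x \in Xs n) /\
    (forall n, exists g : Com S X,
      (forall s, g s \in Xs n) /\ exists s, g s \notin Xs n.+1).
Proof.
move=> sS0 sS Einj ess jn0 nfin.
have [x0 x00] := sS.1; have [t tP] := simple_finite sS0.
(* Com([S], [N]) is infinite-dimensional, expressed inside [Com S X]. This invariant lets the
   construction continue. *)
pose infin (N : subcomodule X) := ~ exists r : seq (Com S X),
  forall g : Com S X, (forall s, g s \in N) -> g \in span (fun v => v \in r).
pose R (N N' : {N | infin N}) := (forall x, x \in sval N' -> x \in sval N) /\
  exists g : Com S X, (forall s, g s \in sval N) /\ exists s, g s \notin sval N'.
have step (N : {N | infin N}) : {N' | R N N'}.
  apply: cid; case: N => N Ninf.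
  have [g g0 gN] : exists2 g : Com S X, g <> 0 & forall s, g s \in N.
    apply: contrapT => ng; apply: Ninf; exists [::] => g gN.
    suff -> : g = 0 by exact: rpred0.
    by apply: contrapT => g0; apply: ng; exists g.
  have gm : @mono (comod_category C) S X g.
    move=> W u v guv; apply: com_eq => w; apply: (simple_com_inj sS g0).
    by have := congr1 (fun F : Com W X => F w) guv.
  (* Since [f] restricts to the nonzero map [j] along [g], the image of [g] is not contained in the
     kernel of [f]. *)
  have [f fg] := Einj _ _ _ j gm.
  have fgE s : f (g s) = j s by rewrite -fg.
  have fl := (comP (f : Com X E)).1.
  have [|a u v [uN u0] [vN v0]|h u hl [uN u0]|N' N'P] :=
    @subcomodule_of k C X (fun x => x \in N /\ (f : Com X E) x = 0).
  - by rewrite rpred0 com0.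
  - by rewrite rpredD ?rpredZ // fl u0 v0 scaler0 addr0.
  - rewrite com_act // u0 (linear_fun0 (act_linear hl)); split=> //.
    exact: subcomodule_act.
  have N'inf : infin N'.
    move=> [r rP]; apply: Ninf.
    have [||U UP] := @subspace_of k (Com S X) (fun g => forall s, g s \in N).
    - by move=> s; exact: rpred0.
    - by move=> a u v uX vX s /=; apply: rpredD; [apply: rpredZ|].
    (* A map out of the simple [S] that kills [x0] is zero, so the kernel of this evaluation on maps
       into [N] consists of maps into [N']. Its values lie in the finite-dimensional image of [j0].
       If Com([S], [N']) were finite-dimensional, Com([S], [N]) would be too. *)
    have evl : linear (fun g : Com S X => (f : Com X E) (g x0)).
      by move=> a u v; rewrite -fl.
    have [u /UP uN fu0|u _|q qP] :=
      @finite_dimensional_ker_im k _ _ _ r (map j0 t) U evl.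
    - apply: rP => s; apply/N'P; split=> //.
      have fu := simple_eval_inj (F := com_comp (f : Com X E) u) sS x00 fu0.
      exact: (congr1 (fun F : Com S E => F s) fu).
    - have [fu0|fu] := EM (com_comp (f : Com X E) u = 0).
        have -> : (f : Com X E) (u x0) = 0 := congr1 (fun F : Com S E => F x0) fu0.
        exact: rpred0.
      have [s sE] := essential_simple sS ess fu x0.
      have -> : (f : Com X E) (u x0) = j0 s := sE.
      exact: span_map (comP j0).1 (tP s).
    - by exists q => u uN; apply/qP/UP.
  exists (exist _ N' N'inf); split=> /= [x /N'P[] //|].
  exists g; split=> //; have [s js] := com_neq0 jn0.
  by exists s; apply/negP => /N'P[_]; rewrite fgE.
have [||h x _ _|X' X'P] := @subcomodule_of k C X (fun=> True) => //.
have X'inf : infin X'.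
  by move=> [r rP]; apply: nfin; exists r => g; apply: rP => s; apply/X'P.
have [Xs [_ XsR]] := dependent_choice step (exist _ X' X'inf).
exists (fun n => sval (Xs n)); split=> [n x|n]; first exact: (XsR n).1.
exact: (XsR n).2.
Qed.

End Simple.

(** * Localization at an injective hull *)

Section Localization.
Variables (k : fieldType) (C : coalgebra k).
Local Notation Comod := (comod_category C).
Variables (S E M : comodule C) (j : Com S E).
Hypotheses (sS : simple_comodule S) (jinj : injective j) (jess : essential j).
Variables (B : preadditive) (T : functor Comod B).
Hypothesis hT : localization_functor (torsion E) T.

(** A map into [G Y] is determined by its transpose, whose source [F X] is zero. *)
Lemma adjoint_eq0 (A : preadditive) (F : functor A B) (G : functor B A)
    (adj : adjunction F G) (X : A) (Y : B) (f : hom X (G Y)) :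
  is_zero (F X) -> f = 0.
Proof.
move=> FX0.
have transpose g : g = fmap G (adj_counit adj Y ** fmap F g) ** adj_unit adj X
    :> hom X (G Y).
  by rewrite fmapM -mcompA -adj_unit_natural mcompA adj_triangle_right mcomp1m.
by rewrite (transpose f) (transpose 0); congr (fmap G _ ** _); exact: is_zeroP.
Qed.

(** A nonzero map from [S'] to [E] has its image in that of [j], so it factors through a map from
    [S'] to [S], bijective by simplicity of both; its inverse is the required map. *)
Lemma simple_of_nontorsion S' : simple_comodule S' -> ~ is_zero (T S') ->
  exists h : Com S S', forall y, exists x, y = h x.
Proof.
move=> sS' nz.
have [f f0] : exists f : Com S' E, f <> 0.
  by apply/existsNP => tor; apply: nz; apply/(loc_kernel hT).
have finj := simple_com_inj sS' f0.
have [h hf] := com_lift jinj (essential_simple sS' jess f0).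
have hE x : f x = j (h x) by rewrite -hf.
have [L LP] := im_subcomodule h.
have hsurj y : exists x, y = h x.
  apply/LP; case: (sS.2 L) => // L0; case: f0; apply: com_eq => x.
  by rewrite hE (L0 (h x)) ?com0 //; apply/LP; exists x.
have [x hx0|h' h'E] := com_factor (p := h) (g := com_id S') hsurj.
  by apply: finj; rewrite com0 hE hx0 com0.
exists h' => y; exists (h y).
by have := congr1 (fun F : Com S' S' => F y) h'E.
Qed.

Lemma artinian_localization :
  (forall N : subcomodule M, finite_dimensional (Com S (quotient_comodule N))) ->
  artinian (T M).
Proof.
move=> fin K m mm mdec.
have [abB Tex _ [G [adj ciso]]] := hT.
have coker n : {Q : B & {q : hom (T M) Q | is_cokernel q (m n)}}.
  by have /cid[Q /cid qP] := abelian_cokernel abB (m n); exists Q.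
pose Q n := projT1 (coker n); pose q n : hom (T M) (Q n) := sval (projT2 (coker n)).
have qP n : is_cokernel (q n) (m n) := svalP (projT2 (coker n)).
(* The transpose of [q n]; [qf] recovers [q n] from it. *)
pose f n : Com M (G (Q n)) := fmap G (q n) ** adj_unit adj M.
have qf n : q n = adj_counit adj (Q n) ** @fmap _ _ T M (G (Q n)) (f n).
  rewrite [X in _ ** X]fmapM mcompA -adj_counit_natural -mcompA adj_triangle_left.
  by rewrite mcompm1.
have fdec n x : f n.+1 x = 0 -> f n x = 0.
  have [h mh] := mdec n.
  have [|r [rq _]] := (qP n.+1).2 _ (q n).
    by rewrite -mh mcompA (qP n).1 mcomp0.
  have -> : f n = com_comp (fmap G r) (f n.+1).
    by rewrite /f -rq fmapM -[LHS]mcompA.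
  by move=> /= ->; exact: com0.
have [|a u v u0 v0 n|h x hl x0 n|N NP] :=
  @subcomodule_of k C M (fun x => forall n, f n x = 0).
- by move=> n; exact: com0.
- by rewrite (comP (f n)).1 u0 v0 scaler0 addr0.
- by rewrite com_act // x0 (linear_fun0 (act_linear hl)).
have [p [psurj pN]] := quotient_map N; set X := quotient_comodule N in p psurj pN.
have [F Fp] : exists F : forall n, Com X (G (Q n)), forall n, com_comp (F n) p = f n.
  have F' n : {F : Com X (G (Q n)) | com_comp F p = f n}.
    by apply: cid; apply: com_factor psurj _ => x /pN/NP.
  by exists (fun n => sval (F' n)) => n; exact: svalP (F' n).
have FE n x : F n (p x) = f n x by rewrite -Fp.
have [Xs XsP] := choice (fun n => ker_subcomodule (F n)).
have Xcap x : (forall n, F n x = 0) -> x = 0.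
  by have [y ->] := psurj x => Fx; apply/pN/NP => n; rewrite -FE.
have [n x||L [x xL x0]|n0 Xn0] :=
  @stationary_of_socle k C S X Xs (fin N).
- by move=> /XsP; have [y ->] := psurj x; rewrite FE => /fdec fy; apply/XsP; rewrite FE.
- by move=> x xX; apply: Xcap => n; apply/XsP.
(* A simple [S'] inside [L] is not killed by every [F n]. As maps from torsion comodules to
   [G (Q n)] vanish, [S'] is not torsion, and [S] maps onto it. *)
- have [S' [i [sS' iinj iL]]] := exists_simple xL x0.
  have [z z0] := sS'.1.
  have [n Fn] : exists n, F n (i z) <> 0.
    apply/existsNP => Fi0; apply: z0; apply: iinj; rewrite com0.
    exact: Xcap.
  have [|h hsurj] := simple_of_nontorsion sS'.
    move=> TS'; have Fi0 := adjoint_eq0 adj (com_comp (F n) i : @hom Comod _ _) TS'.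
    by apply: Fn; have := congr1 (fun H : Com S' (G (Q n)) => H z) Fi0.
  exists (com_comp i h) => [ih0|s]; last exact: iL.
  have [s zE] := hsurj z; apply: z0; apply: iinj; rewrite com0 zE.
  by have := congr1 (fun H : Com S X => H s) ih0.
have Finj : injective (F n0) by apply: com_inj => x /XsP/Xn0.
have qF n : q n = adj_counit adj (Q n) ** @fmap _ _ T X (G (Q n)) (F n)
    ** @fmap _ _ T M X p.
  by rewrite qf -Fp [X in _ ** X]fmapM mcompA.
exists n0 => n _.
have [|h [hm _]] := (mono_is_kernel abB (mm n) (qP n)).2 _ (m n0); last by exists h.
(* Every [q n] factors through [T] of [p], and [q n0] does so by a monomorphism: hence [m n0],
   killed by [q n0], is killed by all [q n]. *)
suff pm : @fmap _ _ T M X p ** m n0 = 0 by rewrite qF -mcompA pm mcompr0.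
have mon := mono_comp (iso_mono (ciso (Q n0))) (fmap_mono Tex Finj).
apply: mon; rewrite mcompr0 mcompA -qF; exact: (qP n0).1.
Qed.

Lemma quasi_finite_of_artinian (S' : comodule C) (j' : Com S' E) (N : subcomodule M) :
  @injective_object Comod E -> simple_comodule S' -> j' <> 0 ->
  artinian (T M) -> finite_dimensional (Com S' (quotient_comodule N)).
Proof.
move=> Einj sS' j'0 art; apply: contrapT => nfin.
have [abB Tex Tker _] := hT.
have [Xs [Xdec Xg]] := socle_filtration sS sS' Einj jess j'0 nfin.
have [p [psurj _]] := quotient_map N; set X := quotient_comodule N in p psurj Xs Xdec Xg.
pose Y n := quotient_comodule (Xs n).
have qm n : {r : Com X (Y n) |
    (forall y, exists x, y = r x) /\ forall x, r x = 0 <-> x \in Xs n}.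
  by apply: cid; exact: quotient_map.
pose r n : Com X (Y n) := sval (qm n).
have rsurj n y : exists x, y = r n x := (svalP (qm n)).1 y.
have rP n x : r n x = 0 <-> x \in Xs n := (svalP (qm n)).2 x.
pose Tr n := @fmap _ _ T X (Y n) (r n); pose Tp := @fmap _ _ T M X p.
(* The chain to be tested consists of the kernels of [T M] → [T (Y n)]. *)
have ker n : {K : B & {m : hom K (T M) | is_kernel m (Tr n ** Tp)}}.
  by have /cid[K /cid mP] := abelian_kernel abB (Tr n ** Tp); exists K.
pose m n : hom (projT1 (ker n)) (T M) := sval (projT2 (ker n)).
have mP n : is_kernel (m n) (Tr n ** Tp) := svalP (projT2 (ker n)).
have [n|n|n0 n0P] := art _ m; first exact: kernel_mono (mP n).
  have [x /rP/Xdec/rP //|h hE] := com_factor (p := r n.+1) (g := r n) (rsurj _).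
  have [|u [uE _]] := (mP n).2 _ (m n.+1); last by exists u.
  have -> : Tr n = @fmap _ _ T (Y n.+1) (Y n) h ** Tr n.+1.
    by rewrite /Tr -hE; exact: fmapM.
  by rewrite -(mcompA _ _ Tp) -mcompA (mP n.+1).1 mcompr0.
have [u uE] := n0P n0.+1 (leqnSn _).
(* This epimorphism is the cokernel of [m n0], which the next map [Tr n0.+1 ** Tp] also kills once
   the chain is stationary. So [Tr n0.+1] factors through [Tr n0]. *)
have epi0 : epi (Tr n0 ** Tp).
  rewrite -fmapM; apply: (fmap_epi (p := com_comp (r n0) p) Tex) => y.
  by have [x ->] := rsurj n0 y; have [z ->] := psurj x; exists z.
have [|h [hE _]] := (epi_is_cokernel abB epi0 (mP n0)).2 _ (Tr n0.+1 ** Tp).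
  by rewrite -uE mcompA (mP n0.+1).1 mcomp0.
have {}hE : h ** Tr n0 = Tr n0.+1.
  by apply: (fmap_epi Tex psurj); rewrite -mcompA.
(* The map [g] vanishes in [Y n0] but embeds [S'] in [Y n0.+1]. By the factorization [T] sends this
   embedding to a zero monomorphism, so [S'] is torsion, against [j']. *)
have [g [gn [s gs]]] := Xg n0.
have rg0 : com_comp (r n0) g = 0 by apply: com_eq => x; apply/rP.
have rg : com_comp (r n0.+1) g <> 0.
  by move=> rg; move/negP: gs; apply; apply/rP; exact: (congr1 (fun H : Com S' _ => H s) rg).
have := fmap_mono Tex (simple_com_inj sS' rg).
have -> : @fmap _ _ T S' (Y n0.+1) (com_comp (r n0.+1) g) = 0.
  rewrite (fmapM T (r n0.+1 : @hom Comod X (Y n0.+1)) g) -[X in X ** _]hE.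
  rewrite -mcompA -fmapM.
  have -> : (r n0 : @hom Comod X (Y n0)) ** g = 0 by exact: rg0.
  by rewrite (fmap0 _ _ Tex.1) mcompr0.
by move=> /mono_zero/Tker/(_ j')/j'0.
Qed.

End Localization.

(** * The equivalence over all isomorphism types of simple comodules *)

Theorem theorem2p9 (k : fieldType) (C : coalgebra k)
    (I : Type) (S : I -> comodule C) (hS : complete_simples S)
    (E : I -> comodule C) (hE : forall i, injective_hull (S i) (E i))
    (D : I -> preadditive)
    (T : forall i, functor (comod_category C) (D i))
    (hT : forall i, localization_functor (torsion (E i)) (T i))
    (M : comodule C) :
  strictly_quasi_finite M <-> forall i, artinian (T i M).
Proof.
have [sS _ allS] := hS; split=> [sqf i|art N S' sS'].
  have [_ [j [jinj jess]]] := hE i.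
  apply: (artinian_localization (sS i) jinj jess (hT i)) => N.
  exact: sqf.
have [i [phi [psi [psi_phi _]]]] := allS S' sS'.
have [Einj [j [jinj jess]]] := hE i.
(* The isomorphism [phi] from [S'] to its representative [S i], followed by the embedding in the
   hull, is a nonzero map. *)
apply: (quasi_finite_of_artinian (sS i) jess (hT i) (j' := com_comp j phi)) => //.
have [x x0] := sS'.1; move=> jphi0; apply: x0.
have phi0 : (phi : Com S' (S i)) x = 0.
  by apply: jinj; rewrite com0; exact: (congr1 (fun F : Com S' (E i) => F x) jphi0).
have <- : (psi : Com (S i) S') ((phi : Com S' (S i)) x) = x.
  exact: (congr1 (fun F : Com S' S' => F x) psi_phi).
by rewrite phi0; exact: com0.
Qed.
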